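(* There exists an algorithm which, given {\sf NACOND} access to two unknown distributions $p, q$ on $[n]$ and a parameter $\varepsilon \in (0,1]$, makes $\tilde O\left(\frac{\log^{12} n}{\varepsilon^2}\right)$ queries to the oracle of each distribution and distinguishes between the cases $p = q$ and $d_{\mathrm{TV}}(p,q) \geq \varepsilon$ with probability at least $2/3$ (i.e., in each of the two cases it outputs the correct answer with probability at least $2/3$).
   Context: Distributions are over the finite domain $[n]=\{1,\dots,n\}$; for $S\subseteq[n]$, $p(S)=\sum_{i\in S}p(i)$, and $p_S$ is the conditional distribution $p_S(i)=p(i)/p(S)$ for $i \in S$. A conditional sampling oracle for $p$ takes as input a query set $S\subseteq[n]$ and returns a symbol $i\in S$ drawn with probability $p(i)/p(S)$; if $p(S)=0$ it returns a uniformly random element of $S$. In the non-adaptive model ({\sf NACOND}), the algorithm must specify all of its query sets (possibly using its own randomness) before seeing the result of any query. Total variation distance: $d_{\mathrm{TV}}(p,q)=\frac12\sum_{i\in[n]}|p(i)-q(i)|$. $\log$ denotes base-2 logarithm; $\tilde O(\cdot)$ hides factors polylogarithmic in its argument (here, factors polynomial in $\log\log n$ and $\log(1/\varepsilon)$). *)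

(* Defs.v *)
From Stdlib Require Import Reals List Lra.
Open Scope R_scope.

Definition sumR (l : list nat) (f : nat -> R) : R :=
  fold_right (fun i acc => f i + acc) 0 l.

Definition dom (n : nat) : list nat := seq 1 n.

Definition is_distr (n : nat) (p : nat -> R) : Prop :=
  (forall i, (1 <= i <= n)%nat -> 0 <= p i) /\ sumR (dom n) p = 1.

(* a query set S ⊆ [n] is represented by its indicator on [n] *)
Definition mass (n : nat) (p : nat -> R) (S : nat -> bool) : R :=
  sumR (dom n) (fun i => if S i then p i else 0).

Definition card_set (n : nat) (S : nat -> bool) : nat :=
  length (filter S (dom n)).

Definition nonempty_in (n : nat) (S : nat -> bool) : Prop :=
  exists i, (1 <= i <= n)%nat /\ S i = true.

Definition cond_prob (n : nat) (p : nat -> R) (S : nat -> bool) (i : nat) : R :=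
  if S i then
    (if Req_EM_T (mass n p S) 0 then / INR (card_set n S) else p i / mass n p S)
  else 0.

Fixpoint exp_answers (n : nat) (p : nat -> R) (Qs : list (nat -> bool))
    (f : list nat -> R) : R :=
  match Qs with
  | nil => f nil
  | T :: Qs' =>
      sumR (dom n) (fun i => cond_prob n p T i * exp_answers n p Qs' (fun a => f (i :: a)))
  end.

(* A non-adaptive conditional-sampling tester (NACOND).  Its internal
   randomness is a seed r drawn from a finite distribution (weights on
   0..na_seeds-1).  Given the seed, it fixes its query sets to the oracle of p
   (na_qp r) and of q (na_qq r) before seeing any answer, then outputs
   na_out r (answers from p) (answers from q); true = "p = q". *)
Record nacond_alg := {
  na_seeds : nat;
  na_weight : nat -> R;
  na_qp : nat -> list (nat -> bool);
  na_qq : nat -> list (nat -> bool);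
  na_out : nat -> list nat -> list nat -> bool }.

Definition well_formed (n : nat) (A : nacond_alg) : Prop :=
  (forall r, (r < na_seeds A)%nat -> 0 <= na_weight A r) /\
  sumR (seq 0 (na_seeds A)) (na_weight A) = 1 /\
  (forall r, (r < na_seeds A)%nat ->
     Forall (nonempty_in n) (na_qp A r) /\ Forall (nonempty_in n) (na_qq A r)).

Definition out_prob (n : nat) (A : nacond_alg) (p q : nat -> R) (b : bool) : R :=
  sumR (seq 0 (na_seeds A)) (fun r =>
    na_weight A r *
    exp_answers n p (na_qp A r) (fun ap =>
      exp_answers n q (na_qq A r) (fun aq =>
        if Bool.eqb (na_out A r ap aq) b then 1 else 0))).

Definition dTV (n : nat) (p q : nat -> R) : R :=
  / 2 * sumR (dom n) (fun i => Rabs (p i - q i)).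

Definition log2 (x : R) : R := ln x / ln 2.

Definition query_bound (C : R) (k : nat) (n : nat) (eps : R) : R :=
  C * (log2 (INR n)) ^ 12 / eps ^ 2 *
  (1 + log2 (1 + log2 (INR n)) + log2 (/ eps)) ^ k.

(* Main.v *)
(** Halve [n] at random, S_0 ⊃ S_1 ⊃ S_2 ⊃ ..., down to level log n, and compare, at every level, how often
    the two oracles answer a query S_l inside S_(l+1).  Let D_l be the difference of the two conditional
    probabilities of S_(l+1).  Given S_l = S, the mean of D_l^2 is a quarter of the squared l2 distance of p_S
    and q_S.  Everything rests on the inequality

      E (D_0^2 + ... + D_J^2) >= eps^2 / (512 (J + 1)^3),   2^J >= n.

    Put m = (p + q) / 2 and d = (p - q) / 2, and call d(S) / m(S) the bias of S.  An element i with m(i)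
    about 2^(-j) and local bias d(i) / m(i) is reached by the chain at level j with probability 2^(-j).  Its
    local bias is the sum of the changes of bias along the chain, because the bias of [n] is 0.  On the
    event that all m(S_l) are at most K 2^(-l), which has conditional probability at least 1/2 by Markov's
    inequality, each of these changes is controlled by the l2 distances, so Cauchy-Schwarz bounds
    sum |d(i)|, which is the total variation distance.

    The tester spends the same number of queries on each scale 2^(-b) of D_l^2: about 2^(B-b) chains with
    about 2^b queries per set, where 2^B is about J / E(sum D_l^2).  A Chernoff bound makes the error per
    comparison exponentially small in B, hence a union bound applies when p = q; when they are far, the
    contributions of all scales to E(sum D_l^2) add up in the exponent of the acceptance probability. *)
Require Import Defs.
From Stdlib Require Import Reals List Lra Lia ZArith.
Import ListNotations.
Open Scope R_scope.

(** * Finite sums *)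

Definition lsum {X : Type} (l : list X) (f : X -> R) : R :=
  fold_right (fun x acc => f x + acc) 0 l.

Lemma sumR_lsum : sumR = @lsum nat.
Proof. reflexivity. Qed.

Lemma lsum_ext {X : Type} (l : list X) (f g : X -> R) :
  (forall x, In x l -> f x = g x) -> lsum l f = lsum l g.
Proof.
  induction l as [|x l IH]; intros H; [reflexivity|]; simpl.
  rewrite H by now left. rewrite IH; [reflexivity|]; intros; apply H; now right.
Qed.

Lemma lsum_le {X : Type} (l : list X) (f g : X -> R) :
  (forall x, In x l -> f x <= g x) -> lsum l f <= lsum l g.
Proof.
  induction l as [|x l IH]; intros H; simpl; [lra|].
  apply Rplus_le_compat; [apply H; now left|].
  apply IH; intros; apply H; now right.
Qed.

Lemma lsum_plus {X : Type} (l : list X) (f g : X -> R) :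
  lsum l (fun x => f x + g x) = lsum l f + lsum l g.
Proof. induction l as [|x l IH]; simpl; [lra|rewrite IH; lra]. Qed.

Lemma lsum_scal {X : Type} (l : list X) (c : R) (f : X -> R) :
  lsum l (fun x => c * f x) = c * lsum l f.
Proof. induction l as [|x l IH]; simpl; [lra|rewrite IH; lra]. Qed.

Lemma lsum_minus {X : Type} (l : list X) (f g : X -> R) :
  lsum l (fun x => f x - g x) = lsum l f - lsum l g.
Proof. induction l as [|x l IH]; simpl; [lra|rewrite IH; lra]. Qed.

Lemma lsum_const {X : Type} (l : list X) (c : R) :
  lsum l (fun _ => c) = INR (length l) * c.
Proof.
  induction l as [|x l IH]; [simpl; lra|].
  cbn [length lsum fold_right]. rewrite S_INR. unfold lsum in IH. rewrite IH. lra.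
Qed.

Lemma lsum_nonneg {X : Type} (l : list X) (f : X -> R) :
  (forall x, In x l -> 0 <= f x) -> 0 <= lsum l f.
Proof.
  intros H. apply Rle_trans with (lsum l (fun _ => 0)).
  - rewrite lsum_const; lra.
  - apply lsum_le; auto.
Qed.

Lemma lsum_app {X : Type} (l l' : list X) (f : X -> R) :
  lsum (l ++ l') f = lsum l f + lsum l' f.
Proof. induction l as [|x l IH]; simpl; [lra|rewrite IH; lra]. Qed.

Lemma lsum_map {X Y : Type} (h : X -> Y) (l : list X) (f : Y -> R) :
  lsum (map h l) f = lsum l (fun x => f (h x)).
Proof. induction l as [|x l IH]; simpl; [reflexivity|now rewrite IH]. Qed.

Lemma lsum_flat_map {X Y : Type} (h : X -> list Y) (l : list X) (f : Y -> R) :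
  lsum (flat_map h l) f = lsum l (fun x => lsum (h x) f).
Proof. induction l as [|x l IH]; simpl; [reflexivity|now rewrite lsum_app, IH]. Qed.

Lemma lsum_seq_shift (a n : nat) (f : nat -> R) :
  lsum (seq (S a) n) f = lsum (seq a n) (fun i => f (S i)).
Proof. rewrite <- seq_shift, lsum_map. reflexivity. Qed.

Lemma lsum_seq_nth {X : Type} (l : list X) (d : X) (f : X -> R) :
  lsum (seq 0 (length l)) (fun r => f (nth r l d)) = lsum l f.
Proof.
  induction l as [|x l IH]; [reflexivity|]. simpl. f_equal.
  rewrite lsum_seq_shift. exact IH.
Qed.

Lemma lsum_delta (l : list nat) (i : nat) (f : nat -> R) :
  NoDup l -> In i l ->
  lsum l (fun k => if Nat.eqb k i then f k else 0) = f i.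
Proof.
  induction l as [|x l IH]; intros Hnd Hin; [destruct Hin|].
  inversion Hnd as [|? ? Hx Hl]; subst. simpl.
  destruct (Nat.eqb_spec x i) as [->|Hne].
  - rewrite (lsum_ext l _ (fun _ => 0)), lsum_const; [lra|].
    intros k Hk. destruct (Nat.eqb_spec k i); [subst; contradiction|reflexivity].
  - destruct Hin as [?|Hin]; [contradiction|]. rewrite IH by assumption. lra.
Qed.

Lemma Rabs_lsum {X : Type} (l : list X) (f : X -> R) :
  Rabs (lsum l f) <= lsum l (fun x => Rabs (f x)).
Proof.
  induction l as [|x l IH]; simpl; [rewrite Rabs_R0; lra|].
  eapply Rle_trans; [apply Rabs_triang|]. lra.
Qed.

Lemma lsum_term_le {X : Type} (l : list X) (f : X -> R) (x : X) :
  (forall y, In y l -> 0 <= f y) -> In x l -> f x <= lsum l f.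
Proof.
  induction l as [|y l IH]; intros H Hx; [destruct Hx|]. simpl.
  assert (0 <= f y) by (apply H; now left).
  assert (0 <= lsum l f) by (apply lsum_nonneg; intros; apply H; now right).
  destruct Hx as [->|Hx]; [lra|].
  assert (f x <= lsum l f) by (apply IH; [intros; apply H; now right|assumption]).
  lra.
Qed.

(** * Expectation functionals *)

(** One interface for uniform averages over lists and for the nested sums over oracle answers.
    Monotonicity already gives invariance under pointwise equality, by antisymmetry, so function
    extensionality is avoided. *)
Record expectation {X : Type} (E : (X -> R) -> R) : Prop := {
  ex_plus : forall f g, E (fun x => f x + g x) = E f + E g;
  ex_scal : forall c f, E (fun x => c * f x) = c * E f;
  ex_le : forall f g, (forall x, f x <= g x) -> E f <= E g;
  ex_one : E (fun _ => 1) = 1 }.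

Section Expectation.
Context {X : Type} {E : (X -> R) -> R} (HE : expectation E).

Lemma ex_ext (f g : X -> R) : (forall x, f x = g x) -> E f = E g.
Proof.
  intros H; apply Rle_antisym; apply (ex_le _ HE); intros x; rewrite H; lra.
Qed.

Lemma ex_const (c : R) : E (fun _ => c) = c.
Proof.
  rewrite (ex_ext _ (fun _ => c * 1)) by (intros; lra).
  rewrite (ex_scal _ HE), (ex_one _ HE). lra.
Qed.

Lemma ex_minus (f g : X -> R) : E (fun x => f x - g x) = E f - E g.
Proof.
  rewrite (ex_ext _ (fun x => f x + (-1) * g x)) by (intros; lra).
  rewrite (ex_plus _ HE), (ex_scal _ HE). lra.
Qed.

Lemma ex_nonneg (f : X -> R) : (forall x, 0 <= f x) -> 0 <= E f.
Proof. intros H. rewrite <- (ex_const 0). now apply (ex_le _ HE). Qed.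

Lemma ex_lsum {Y : Type} (l : list Y) (f : Y -> X -> R) :
  E (fun x => lsum l (fun y => f y x)) = lsum l (fun y => E (f y)).
Proof.
  induction l as [|y l IH]; simpl; [apply ex_const|].
  rewrite (ex_plus _ HE (f y)). now f_equal.
Qed.

End Expectation.

(** * Uniform averages over lists and tuples *)

Definition avg {X : Type} (l : list X) (f : X -> R) : R :=
  lsum l f / INR (length l).

Lemma avg_expectation {X : Type} (l : list X) : l <> [] -> expectation (avg l).
Proof.
  intros Hl.
  assert (Hpos : 0 < INR (length l)).
  { destruct l; [contradiction|]. apply lt_0_INR. simpl. lia. }
  unfold avg. split; intros.
  - rewrite lsum_plus. field. lra.
  - rewrite lsum_scal. field. lra.
  - apply Rmult_le_compat_r; [left; now apply Rinv_0_lt_compat|].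
    apply lsum_le; auto.
  - rewrite lsum_const. field. lra.
Qed.

Fixpoint tuples {X : Type} (k : nat) (l : list X) : list (list X) :=
  match k with
  | O => [[]]
  | S k' => flat_map (fun x => map (cons x) (tuples k' l)) l
  end.

Lemma tuples_length {X : Type} (k : nat) (l : list X) :
  length (tuples k l) = (length l ^ k)%nat.
Proof.
  induction k as [|k IH]; [reflexivity|]. simpl.
  rewrite (flat_map_constant_length (c := length (tuples k l))); [now rewrite IH|].
  intros. apply length_map.
Qed.

Lemma in_tuples_length {X : Type} (k : nat) (l : list X) (t : list X) :
  In t (tuples k l) -> length t = k.
Proof.
  revert t; induction k as [|k IH]; simpl; intros t Ht.
  - destruct Ht as [<-|[]]. reflexivity.
  - apply in_flat_map in Ht as [x [_ Ht]]. apply in_map_iff in Ht as [t' [<- Ht]].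
    simpl. f_equal. now apply IH.
Qed.

Lemma tuples_nonempty {X : Type} (k : nat) (l : list X) : l <> [] -> tuples k l <> [].
Proof.
  intros Hl H. apply (f_equal (@length _)) in H. rewrite tuples_length in H.
  simpl in H. destruct l; [contradiction|].
  apply Nat.pow_eq_0_iff in H. simpl in H. lia.
Qed.

Lemma avg_tuples_0 {X : Type} (l : list X) (f : list X -> R) :
  avg (tuples 0 l) f = f [].
Proof. unfold avg. simpl. field. Qed.

Lemma avg_tuples_S {X : Type} (k : nat) (l : list X) (f : list X -> R) :
  l <> [] ->
  avg (tuples (S k) l) f = avg l (fun x => avg (tuples k l) (fun t => f (x :: t))).
Proof.
  intros Hl. unfold avg at 1. rewrite tuples_length. simpl tuples.
  rewrite lsum_flat_map.
  assert (Hl0 : INR (length l) <> 0) by (destruct l; [contradiction|apply not_0_INR; simpl; lia]).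
  rewrite (lsum_ext l _ (fun x => INR (length l ^ k) * avg (tuples k l) (fun t => f (x :: t)))).
  - rewrite lsum_scal. unfold avg at 2. simpl. rewrite mult_INR, pow_INR.
    field. split; [assumption|]. apply pow_nonzero; assumption.
  - intros x _. rewrite lsum_map. unfold avg. rewrite tuples_length, pow_INR.
    field. apply pow_nonzero; assumption.
Qed.

Definition lprod {X : Type} (l : list X) (g : X -> R) : R :=
  fold_right (fun x acc => g x * acc) 1 l.

(** Independence: the coordinates of a uniformly random tuple are independent, so the average of a
    product over coordinates factors. Later [js] lists the scales and each coordinate is a chain of
    masks. *)
Lemma avg_tuples_combine {X Y : Type} (js : list Y) (l : list X) (g : Y -> X -> R) :
  l <> [] ->
  avg (tuples (length js) l) (fun t => lprod (combine js t) (fun yx => g (fst yx) (snd yx))) =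
  lprod js (fun y => avg l (g y)).
Proof.
  intros Hl. induction js as [|y js IH]; [apply avg_tuples_0|].
  cbn [length]. rewrite avg_tuples_S by assumption.
  assert (Hk := avg_expectation _ (tuples_nonempty (length js) l Hl)).
  rewrite (ex_ext (avg_expectation _ Hl) _
    (fun x => lprod js (fun y => avg l (g y)) * g y x)).
  - rewrite (ex_scal _ (avg_expectation _ Hl)). simpl.
    change (avg l (fun x => g y x)) with (avg l (g y)). ring.
  - intros x. rewrite (ex_ext Hk _ (fun t => g y x *
      lprod (combine js t) (fun yx => g (fst yx) (snd yx)))) by reflexivity.
    rewrite (ex_scal _ Hk), IH. ring.
Qed.

(** * Uniformly random subsets *)

(* [i : nat] ranges over 1..n, hence the shift. *)
Definition bit (B : list bool) (i : nat) : bool := nth (i - 1) B false.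

Definition Ehalf (n : nat) : (list bool -> R) -> R := avg (tuples n [true; false]).

Lemma Ehalf_expectation (n : nat) : expectation (Ehalf n).
Proof. apply avg_expectation, tuples_nonempty. discriminate. Qed.

Lemma avg_bool (f : bool -> R) : avg [true; false] f = (f true + f false) / 2.
Proof. unfold avg. simpl. lra. Qed.

Definition lin (n : nat) (x : nat -> R) (B : list bool) : R :=
  lsum (dom n) (fun i => if bit B i then x i else 0).

Lemma lin_cons (n : nat) (x : nat -> R) (b : bool) (B : list bool) :
  lin (S n) x (b :: B) = (if b then x 1%nat else 0) + lin n (fun i => x (S i)) B.
Proof.
  unfold lin, dom. simpl. f_equal. rewrite lsum_seq_shift.
  apply lsum_ext. intros i Hi. apply in_seq in Hi. unfold bit.
  replace (S i - 1)%nat with (S (i - 1)) by lia. reflexivity.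
Qed.

Lemma Ehalf_S (n : nat) (f : list bool -> R) :
  Ehalf (S n) f =
  (Ehalf n (fun B => f (true :: B)) + Ehalf n (fun B => f (false :: B))) / 2.
Proof. unfold Ehalf. rewrite avg_tuples_S by discriminate. apply avg_bool. Qed.

Lemma lsum_dom_S (n : nat) (x : nat -> R) :
  lsum (dom (S n)) x = x 1%nat + lsum (dom n) (fun i => x (S i)).
Proof. unfold dom. simpl. f_equal. apply lsum_seq_shift. Qed.

Lemma Ehalf_lin (n : nat) (x : nat -> R) : Ehalf n (lin n x) = / 2 * lsum (dom n) x.
Proof.
  revert x; induction n as [|n IH]; intros x.
  - unfold Ehalf. rewrite avg_tuples_0. unfold lin. simpl. lra.
  - rewrite Ehalf_S, lsum_dom_S.
    rewrite (ex_ext (Ehalf_expectation n) _ (fun B => x 1%nat + lin n (fun i => x (S i)) B))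
      by (intros; apply lin_cons).
    rewrite (ex_ext (Ehalf_expectation n) (fun B => lin (S n) x (false :: B))
      (fun B => 0 + lin n (fun i => x (S i)) B)) by (intros; apply lin_cons).
    rewrite !(ex_plus _ (Ehalf_expectation n)), !(ex_const (Ehalf_expectation n)).
    change (Ehalf n (fun B => lin n (fun i => x (S i)) B)) with (Ehalf n (lin n (fun i => x (S i)))).
    rewrite IH. lra.
Qed.

(** Two distinct bits are both set with probability 1/4, a bit and itself with probability 1/2; the
    diagonal therefore carries an extra 1/4. *)
Lemma Ehalf_lin_lin (n : nat) (x y : nat -> R) :
  Ehalf n (fun B => lin n x B * lin n y B) =
  / 4 * (lsum (dom n) x * lsum (dom n) y) + / 4 * lsum (dom n) (fun i => x i * y i).
Proof.
  revert x y; induction n as [|n IH]; intros x y.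
  - unfold Ehalf. rewrite avg_tuples_0. unfold lin. simpl. lra.
  - rewrite Ehalf_S, !lsum_dom_S.
    set (x' := fun i => x (S i)). set (y' := fun i => y (S i)).
    assert (HE := Ehalf_expectation n).
    rewrite (ex_ext HE (fun B => lin (S n) x (true :: B) * _)
      (fun B => (x 1%nat * y 1%nat + x 1%nat * lin n y' B) +
                (y 1%nat * lin n x' B + lin n x' B * lin n y' B)))
      by (intros; rewrite !lin_cons; unfold x', y'; ring).
    rewrite (ex_ext HE (fun B => lin (S n) x (false :: B) * _)
      (fun B => lin n x' B * lin n y' B))
      by (intros; rewrite !lin_cons; unfold x', y'; ring).
    rewrite !(ex_plus _ HE), !(ex_scal _ HE), (ex_const HE).
    change (Ehalf n (fun B => lin n x' B)) with (Ehalf n (lin n x')).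
    change (Ehalf n (fun B => lin n y' B)) with (Ehalf n (lin n y')).
    rewrite !Ehalf_lin, IH. unfold x', y'. lra.
Qed.

(** Writes a single bit as a linear form, so that the moments involving one fixed bit become cases
    of the two previous moment formulas. *)
Lemma lin_delta (n i : nat) (c : R) (B : list bool) :
  (1 <= i <= n)%nat ->
  lin n (fun k => if Nat.eqb k i then c else 0) B = if bit B i then c else 0.
Proof.
  intros Hi. unfold lin.
  rewrite (lsum_ext _ _ (fun k => if Nat.eqb k i then (if bit B k then c else 0) else 0)).
  - apply (lsum_delta _ i (fun k => if bit B k then c else 0)).
    + apply seq_NoDup.
    + apply in_seq. lia.
  - intros k _. destruct (Nat.eqb k i), (bit B k); reflexivity.
Qed.

Lemma Ehalf_bit (n i : nat) (c : R) :
  (1 <= i <= n)%nat -> Ehalf n (fun B => if bit B i then c else 0) = / 2 * c.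
Proof.
  intros Hi. rewrite (ex_ext (Ehalf_expectation n) _
    (lin n (fun k => if Nat.eqb k i then c else 0))) by (intros; now rewrite lin_delta).
  rewrite Ehalf_lin. f_equal. apply (lsum_delta _ i (fun _ => c)).
  - apply seq_NoDup.
  - apply in_seq. lia.
Qed.

Lemma Ehalf_bit_lin (n i : nat) (x : nat -> R) :
  (1 <= i <= n)%nat ->
  Ehalf n (fun B => if bit B i then lin n x B else 0) = / 4 * (lsum (dom n) x + x i).
Proof.
  intros Hi. rewrite (ex_ext (Ehalf_expectation n) _
    (fun B => lin n (fun k => if Nat.eqb k i then 1 else 0) B * lin n x B)).
  - rewrite Ehalf_lin_lin.
    rewrite (lsum_ext _ (fun k => (if Nat.eqb k i then 1 else 0) * x k)
      (fun k => if Nat.eqb k i then x k else 0))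
      by (intros k _; destruct (Nat.eqb k i); lra).
    assert (Hnd : NoDup (dom n)) by apply seq_NoDup.
    assert (Hin : In i (dom n)) by (apply in_seq; lia).
    rewrite (lsum_delta _ i (fun _ => 1)), (lsum_delta _ i x) by assumption. lra.
  - intros B. rewrite lin_delta by assumption. destruct (bit B i); lra.
Qed.
(** * Random halving chains *)

Definition inter (S : nat -> bool) (B : list bool) : nat -> bool :=
  fun i => (S i && bit B i)%bool.

Lemma mass_inter (n : nat) (x : nat -> R) (S : nat -> bool) (B : list bool) :
  mass n x (inter S B) = lin n (fun i => if S i then x i else 0) B.
Proof.
  unfold mass, lin, inter. rewrite sumR_lsum. apply lsum_ext.
  intros i _. destruct (S i), (bit B i); reflexivity.
Qed.

Lemma mass_nonneg (n : nat) (x : nat -> R) (S : nat -> bool) :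
  (forall i, (1 <= i <= n)%nat -> 0 <= x i) -> 0 <= mass n x S.
Proof.
  intros H. apply lsum_nonneg. intros i Hi. apply in_seq in Hi.
  destruct (S i); [apply H; lia|lra].
Qed.

Lemma mass_ge_term (n : nat) (x : nat -> R) (S : nat -> bool) (i : nat) :
  (forall i, (1 <= i <= n)%nat -> 0 <= x i) ->
  (1 <= i <= n)%nat -> S i = true -> x i <= mass n x S.
Proof.
  intros H Hi HS.
  pose proof (lsum_term_le (dom n) (fun i => if S i then x i else 0) i) as Hle.
  cbv beta in Hle. rewrite HS in Hle. apply Hle.
  - intros y Hy. apply in_seq in Hy. destruct (S y); [apply H; lia|lra].
  - apply in_seq. lia.
Qed.

Lemma mass_Rabs_le (n : nat) (x y : nat -> R) (S : nat -> bool) :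
  (forall i, (1 <= i <= n)%nat -> Rabs (y i) <= x i) ->
  Rabs (mass n y S) <= mass n x S.
Proof.
  intros H. unfold mass. rewrite sumR_lsum.
  eapply Rle_trans; [apply Rabs_lsum|]. apply lsum_le. intros i Hi.
  apply in_seq in Hi. destruct (S i); [apply H; lia|rewrite Rabs_R0; lra].
Qed.

(** The expected total weight of the next [k] sets of a random halving chain standing at [S] on
    level [l]. The recursion replaces a probability space of chains. *)
Fixpoint chain_sum (n : nat) (w : nat -> (nat -> bool) -> R) (k l : nat)
    (S : nat -> bool) : R :=
  match k with
  | O => 0
  | Datatypes.S k' =>
      w l S + Ehalf n (fun B => chain_sum n w k' (Datatypes.S l) (inter S B))
  end.

Lemma chain_sum_le (n : nat) (w w' : nat -> (nat -> bool) -> R) (k l : nat) (S : nat -> bool) :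
  (forall l S, w l S <= w' l S) -> chain_sum n w k l S <= chain_sum n w' k l S.
Proof.
  intros H. revert l S; induction k as [|k IH]; intros l S; simpl; [lra|].
  apply Rplus_le_compat; [apply H|]. apply (ex_le _ (Ehalf_expectation n)). auto.
Qed.

Lemma chain_sum_plus (n : nat) (w w' : nat -> (nat -> bool) -> R) (k l : nat) (S : nat -> bool) :
  chain_sum n (fun l S => w l S + w' l S) k l S = chain_sum n w k l S + chain_sum n w' k l S.
Proof.
  revert l S; induction k as [|k IH]; intros l S; simpl; [lra|].
  rewrite (ex_ext (Ehalf_expectation n) _ _ (fun B => IH _ _)).
  rewrite (ex_plus _ (Ehalf_expectation n)). lra.
Qed.

Lemma chain_sum_scal (n : nat) (c : R) (w : nat -> (nat -> bool) -> R) (k l : nat)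
    (S : nat -> bool) :
  chain_sum n (fun l S => c * w l S) k l S = c * chain_sum n w k l S.
Proof.
  revert l S; induction k as [|k IH]; intros l S; simpl; [lra|].
  rewrite (ex_ext (Ehalf_expectation n) _ _ (fun B => IH _ _)).
  rewrite (ex_scal _ (Ehalf_expectation n)). lra.
Qed.

Lemma chain_sum_const (n : nat) (c : R) (k l : nat) (S : nat -> bool) :
  chain_sum n (fun _ _ => c) k l S = INR k * c.
Proof.
  revert l S; induction k as [|k IH]; intros l S; [simpl; lra|].
  cbn [chain_sum]. rewrite (ex_ext (Ehalf_expectation n) _ _ (fun B => IH _ _)).
  rewrite (ex_const (Ehalf_expectation n)), S_INR. lra.
Qed.

Lemma chain_sum_nonneg (n : nat) (w : nat -> (nat -> bool) -> R) (k l : nat) (S : nat -> bool) :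
  (forall l S, 0 <= w l S) -> 0 <= chain_sum n w k l S.
Proof.
  intros H. apply Rle_trans with (chain_sum n (fun _ _ => 0) k l S).
  - rewrite chain_sum_const. lra.
  - now apply chain_sum_le.
Qed.

Lemma Rabs_le_0 (x : R) : Rabs x <= 0 -> x = 0.
Proof. unfold Rabs. destruct (Rcase_abs x); lra. Qed.

(** * Drift of the bias along a chain *)

Section Chain.
Context (n : nat) (m d : nat -> R)
  (Hd : forall i, (1 <= i <= n)%nat -> Rabs (d i) <= m i)
  (lev : nat -> nat) (K eta : R) (HK : 0 < K) (Heta : 0 < eta).

Let m_nonneg (i : nat) : (1 <= i <= n)%nat -> 0 <= m i.
Proof. intros Hi. eapply Rle_trans; [apply Rabs_pos|now apply Hd]. Qed.

Definition bias (S : nat -> bool) : R := mass n d S / mass n m S.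

(** On a set of mass zero, [Hd] forces [mass n d S] to vanish as well, so no case distinction is
    needed afterwards. *)
Lemma mass_bias (S : nat -> bool) : mass n m S * bias S = mass n d S.
Proof.
  unfold bias. destruct (Req_dec (mass n m S) 0) as [H0|H0]; [|field; assumption].
  pose proof (mass_Rabs_le n m d S Hd) as H. rewrite H0 in *.
  pose proof (Rabs_pos (mass n d S)) as Hp.
  assert (mass n d S = 0) as ->; [|lra].
  apply Rabs_le_0. lra.
Qed.

(** With [m] and [d] the half sum and half difference of [p] and [q], this is half of [p_S - q_S]
    times a damping factor at most 1, provided that both masses are positive; see [devsq_le_gap]. *)
Definition dev (S : nat -> bool) (i : nat) : R :=
  if S i then (d i - m i * bias S) / mass n m S else 0.

Definition devsq (S : nat -> bool) : R := lsum (dom n) (fun i => dev S i * dev S i).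

Lemma devsq_nonneg (S : nat -> bool) : 0 <= devsq S.
Proof. apply lsum_nonneg. intros. apply Rle_0_sqr. Qed.

Lemma mass_dev (S : nat -> bool) (i : nat) :
  (1 <= i <= n)%nat -> S i = true -> mass n m S * dev S i = d i - m i * bias S.
Proof.
  intros Hi HS. unfold dev. rewrite HS.
  destruct (Req_dec (mass n m S) 0) as [H0|H0]; [|field; assumption].
  pose proof (mass_ge_term n m S i m_nonneg Hi HS) as Hmi.
  pose proof (m_nonneg i Hi). pose proof (Hd i Hi). pose proof (Rabs_pos (d i)).
  assert (Hm : m i = 0) by lra.
  assert (d i = 0) as -> by (apply Rabs_le_0; lra).
  rewrite H0, Hm. ring.
Qed.

Lemma lsum_dev (S : nat -> bool) : lsum (dom n) (dev S) = 0.
Proof.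
  destruct (Req_dec (mass n m S) 0) as [H0|H0].
  - rewrite (lsum_ext _ _ (fun _ => 0)), lsum_const; [lra|].
    intros i _. unfold dev. rewrite H0. unfold Rdiv. rewrite Rinv_0.
    destruct (S i); ring.
  - apply Rmult_eq_reg_l with (mass n m S); [|assumption].
    rewrite <- lsum_scal.
    rewrite (lsum_ext _ _ (fun i => (if S i then d i else 0) + (- bias S) * (if S i then m i else 0))).
    + rewrite lsum_plus, lsum_scal. change (lsum (dom n) (fun i => if S i then d i else 0)) with (mass n d S).
      change (lsum (dom n) (fun i => if S i then m i else 0)) with (mass n m S).
      rewrite <- mass_bias. ring.
    + intros i Hi. apply in_seq in Hi. destruct (S i) eqn:HS.
      * rewrite mass_dev by (lia || assumption). ring.
      * unfold dev. rewrite HS. ring.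
Qed.

(** Both sides are the absolute value of [mass n d (inter S B) - bias S * mass n m (inter S B)]. The
    change of bias in one halving thus becomes a linear form in independent bits. *)
Lemma mass_bias_inter (S : nat -> bool) (B : list bool) :
  mass n m (inter S B) * Rabs (bias (inter S B) - bias S) =
  mass n m S * Rabs (lin n (dev S) B).
Proof.
  rewrite <- (Rabs_pos_eq (mass n m (inter S B))) at 1 by (apply mass_nonneg, m_nonneg).
  rewrite <- (Rabs_pos_eq (mass n m S)) at 1 by (apply mass_nonneg, m_nonneg).
  rewrite <- !Rabs_mult. f_equal.
  rewrite Rmult_minus_distr_l, mass_bias, !mass_inter. unfold lin.
  rewrite <- lsum_scal.
  rewrite (lsum_ext _ (fun x => mass n m S * _)
    (fun i => (if bit B i then if S i then d i else 0 else 0) -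
       bias S * (if bit B i then if S i then m i else 0 else 0))).
  - rewrite lsum_minus, lsum_scal. ring.
  - intros i Hi. apply in_seq in Hi. destruct (bit B i); [|ring].
    destruct (S i) eqn:HS.
    + rewrite mass_dev by (lia || assumption). ring.
    + unfold dev. rewrite HS. ring.
Qed.

(** The linear form of Cauchy-Schwarz: with a fixed [eta] the bounds stay linear in the squares and
    can be added along the chain; [eta] is chosen only in [chain_energy]. *)
Lemma amgm (x : R) : Rabs x <= eta / 2 + x * x / (2 * eta).
Proof.
  assert (H : 0 <= (Rabs x - eta) * (Rabs x - eta)) by apply Rle_0_sqr.
  assert (Hx : Rabs x * Rabs x = x * x) by (rewrite <- Rabs_mult; apply Rabs_pos_eq, Rle_0_sqr).
  apply Rmult_le_reg_r with (2 * eta); [lra|].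
  replace ((eta / 2 + x * x / (2 * eta)) * (2 * eta)) with (eta * eta + x * x) by (field; lra).
  nra.
Qed.

(** Since [dev S] sums to 0, the second moment of [lin n (dev S)] is just [devsq S / 4]; [amgm]
    turns it into a bound on the first moment. *)
Lemma Ehalf_bias_drift (S : nat -> bool) :
  2 * Ehalf n (fun B => mass n m (inter S B) * Rabs (bias (inter S B) - bias S)) <=
  mass n m S * (eta / 2 + devsq S / (2 * eta)).
Proof.
  assert (HE := Ehalf_expectation n).
  rewrite (ex_ext HE _ _ (mass_bias_inter S)), (ex_scal _ HE).
  assert (HM : 0 <= mass n m S) by (apply mass_nonneg, m_nonneg).
  assert (H : 2 * Ehalf n (fun B => Rabs (lin n (dev S) B)) <= eta / 2 + devsq S / (2 * eta)).
  { apply Rle_trans with (Ehalf n (fun B => eta / 2 + 2 / eta * (lin n (dev S) B * lin n (dev S) B))).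
    - rewrite <- (ex_scal _ HE). apply (ex_le _ HE). intros B.
      pose proof (amgm (2 * lin n (dev S) B)) as Ha.
      rewrite Rabs_mult, (Rabs_pos_eq 2) in Ha by lra.
      eapply Rle_trans; [exact Ha|]. right. field. lra.
    - rewrite (ex_plus _ HE), (ex_scal _ HE), (ex_const HE), Ehalf_lin_lin, lsum_dev.
      fold (devsq S). right. field. lra. }
  nra.
Qed.

(* Conditioned on [i] surviving down to level [lev i], the probability that no set of the chain
   met on the way is atypically heavy; the factor 2 per level undoes the conditioning. *)
Fixpoint surv (i k l : nat) (S : nat -> bool) : R :=
  match k with
  | O => 0
  | Datatypes.S k' =>
      if Rle_dec (mass n m S) (K / 2 ^ l) then
        (if (S i && Nat.eqb (lev i) l)%bool then 1 else 0) +
        2 * Ehalf n (fun B => surv i k' (Datatypes.S l) (inter S B))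
      else 0
  end.

(** The factor 2 in [surv] is cancelled by the probability 1/2 that a mask keeps [i], so the weight
    never exceeds 1; it is 0 once the level of [i] has been passed. *)
Lemma surv_bounds (i k l : nat) (S : nat -> bool) :
  (1 <= i <= n)%nat ->
  0 <= surv i k l S <= if (S i && Nat.leb l (lev i))%bool then 1 else 0.
Proof.
  intros Hi. assert (HE := Ehalf_expectation n).
  revert l S; induction k as [|k IH]; intros l S; simpl.
  { destruct (_ && _)%bool; lra. }
  destruct (Rle_dec _ _) as [_|_]; [|destruct (_ && _)%bool; lra].
  set (E := Ehalf n _).
  assert (H0 : 0 <= E) by (apply (ex_nonneg HE); intros; apply IH).
  assert (H1 : E <= / 2 * (if (S i && Nat.leb (Datatypes.S l) (lev i))%bool then 1 else 0)).
  { unfold E. rewrite <- (Ehalf_bit n i _ Hi). apply (ex_le _ HE). intros B.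
    eapply Rle_trans; [apply IH|]. unfold inter.
    destruct (S i), (bit B i); cbn [andb]; try lra. }
  destruct (S i); cbn [andb] in *; [|lra].
  destruct (Nat.eqb_spec (lev i) l) as [He|He];
    destruct (Nat.leb_spec (Datatypes.S l) (lev i)) as [Hl|Hl];
    destruct (Nat.leb_spec l (lev i)); try lia; lra.
Qed.

(** Markov's inequality with a union bound. Given that [i] survives, [2 ^ j] times the mass of the
    set on level [j] has mean [(2 ^ j - 2 ^ l) * m i + 2 ^ l * mass n m S], which is largest at
    [j = lev i]; there are [lev i + 1 - l] levels. *)
Lemma surv_lower (i k l : nat) (S : nat -> bool) :
  (1 <= i <= n)%nat -> S i = true -> (l <= lev i < l + k)%nat ->
  1 - INR (lev i + 1 - l) / K * ((2 ^ lev i - 2 ^ l) * m i + 2 ^ l * mass n m S) <= surv i k l S.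
Proof.
  intros Hi. assert (HE := Ehalf_expectation n).
  revert l S; induction k as [|k IH]; intros l S HS Hl; [lia|]. cbn [surv].
  set (t := (lev i - l)%nat).
  assert (Ht : lev i = (t + l)%nat) by (unfold t; lia).
  replace (lev i + 1 - l)%nat with (Datatypes.S t) by lia.
  assert (Hp : 0 < 2 ^ l) by (apply pow_lt; lra).
  assert (Hpp : 2 ^ l <= 2 ^ lev i) by (apply Rle_pow; [lra|lia]).
  assert (Hm := m_nonneg i Hi).
  assert (HM : 0 <= mass n m S) by (apply mass_nonneg, m_nonneg).
  assert (Hq : 0 <= (2 ^ lev i - 2 ^ l) * m i) by nra.
  assert (HtK : 0 <= INR t / K)
    by (apply Rmult_le_pos; [apply pos_INR|left; now apply Rinv_0_lt_compat]).
  destruct (Rle_dec _ _) as [Hg|Hg].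
  (* The current set is too heavy: the summand for this level alone exceeds 1, so the claimed lower
     bound is negative. *)
  2:{ apply Rnot_le_lt in Hg.
      assert (HKM : 1 < 2 ^ l * mass n m S / K).
      { apply Rmult_lt_reg_r with (K / 2 ^ l); [now apply Rdiv_lt_0_compat|].
        replace (2 ^ l * mass n m S / K * (K / 2 ^ l)) with (mass n m S) by (field; lra). lra. }
      rewrite S_INR.
      replace ((INR t + 1) / K * ((2 ^ lev i - 2 ^ l) * m i + 2 ^ l * mass n m S))
        with (INR t / K * ((2 ^ lev i - 2 ^ l) * m i + 2 ^ l * mass n m S)
              + (2 ^ lev i - 2 ^ l) * m i * / K + 2 ^ l * mass n m S / K) by (field; lra).
      assert (0 < / K) by now apply Rinv_0_lt_compat.
      assert (0 <= (2 ^ lev i - 2 ^ l) * m i * / K) by (apply Rmult_le_pos; lra).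
      assert (0 <= INR t / K * ((2 ^ lev i - 2 ^ l) * m i + 2 ^ l * mass n m S))
        by (apply Rmult_le_pos; nra).
      lra. }
  set (E := Ehalf n _). rewrite HS. cbn [andb].
  assert (HKM : 0 <= 1 / K * ((2 ^ lev i - 2 ^ l) * m i + 2 ^ l * mass n m S)).
  { apply Rmult_le_pos; [|nra]. left. apply Rdiv_lt_0_compat; lra. }
  assert (HE0 : 0 <= E) by (apply (ex_nonneg HE); intros; now apply surv_bounds).
  destruct (Nat.eqb_spec (lev i) l) as [He|He].
  { assert (t = 0%nat) as Ht0 by lia. rewrite Ht0 in *. change (INR 1) with 1. lra. }
  rewrite Rplus_0_l.
  set (a := (2 ^ lev i - 2 * 2 ^ l) * m i).
  (* Only masks keeping [i] count. The induction hypothesis is averaged exactly over them and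
     reproduces the same bracket with one level fewer; the share of the current level is dropped by
     [HKM]. *)
  apply Rle_trans with (2 * Ehalf n (fun B => (if bit B i then 1 - INR t / K * a else 0) -
    INR t / K * (2 * 2 ^ l) * (if bit B i then lin n (fun i => if S i then m i else 0) B else 0))).
  - rewrite (ex_minus HE), (ex_scal _ HE), Ehalf_bit, Ehalf_bit_lin by assumption.
    rewrite HS. change (lsum (dom n) (fun i => if S i then m i else 0)) with (mass n m S).
    rewrite S_INR. unfold a.
    apply Rle_trans with (1 - INR t / K * ((2 ^ lev i - 2 ^ l) * m i + 2 ^ l * mass n m S)).
    + replace ((INR t + 1) / K) with (INR t / K + 1 / K) by (field; lra). lra.
    + right. field. lra.
  - apply Rmult_le_compat_l; [lra|]. apply (ex_le _ HE). intros B.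
    destruct (bit B i) eqn:Hb.
    + specialize (IH (Datatypes.S l) (inter S B)).
      replace (lev i + 1 - Datatypes.S l)%nat with t in IH by lia.
      rewrite <- mass_inter. cbn [pow] in IH. unfold a.
      eapply Rle_trans; [|apply IH; [unfold inter; now rewrite HS, Hb|lia]].
      right. ring.
    + rewrite Rmult_0_r, Rminus_0_r. now apply surv_bounds.
Qed.

Definition level_count (l : nat) (S : nat -> bool) : R :=
  lsum (dom n) (fun i => if (S i && Nat.eqb (lev i) l)%bool then 1 else 0).

(** An element of [S] arrives at its own level with probability [2 ^ l / 2 ^ lev i], and it is
    counted on that level only. *)
Lemma chain_sum_level_count (k l : nat) (S : nat -> bool) :
  chain_sum n level_count k l S <=
  lsum (dom n) (fun i => if (S i && Nat.leb l (lev i))%bool then 2 ^ l / 2 ^ lev i else 0).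
Proof.
  assert (HE := Ehalf_expectation n).
  revert l S; induction k as [|k IH]; intros l S; cbn [chain_sum].
  { apply lsum_nonneg. intros i _. destruct (_ && _)%bool; [|lra].
    apply Rlt_le, Rdiv_lt_0_compat; apply pow_lt; lra. }
  eapply Rle_trans.
  { apply Rplus_le_compat_l, (ex_le _ HE). intros B. apply IH. }
  unfold inter, level_count.
  rewrite (ex_lsum HE), <- lsum_plus. apply lsum_le. intros i Hi. apply in_seq in Hi.
  rewrite (ex_ext HE _ (fun B => if bit B i then
     (if (S i && Nat.leb (Datatypes.S l) (lev i))%bool then 2 ^ Datatypes.S l / 2 ^ lev i else 0) else 0))
    by (intros B; destruct (S i), (bit B i); reflexivity).
  rewrite Ehalf_bit by lia.
  assert (0 < 2 ^ lev i) by (apply pow_lt; lra).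
  assert (0 < 2 ^ l) by (apply pow_lt; lra).
  destruct (S i); cbn [andb]; [|lra].
  destruct (Nat.eqb_spec (lev i) l) as [He|He];
    destruct (Nat.leb_spec (Datatypes.S l) (lev i)) as [Hl|Hl];
    destruct (Nat.leb_spec l (lev i)); try lia; try lra.
  - rewrite He. right. field. lra.
  - cbn [pow]. right. field. lra.
Qed.

(** The first term and half of the [devsq] term pay for the elements that stop on this level; the
    constant and the other half pay for the drift of the bias. *)
Definition chain_cost (l : nat) (S : nat -> bool) : R :=
  eta / 2 * level_count l S + (eta / 2 + / eta * devsq S).

Lemma chain_cost_nonneg (l : nat) (S : nat -> bool) : 0 <= chain_cost l S.
Proof.
  unfold chain_cost. pose proof (devsq_nonneg S).
  assert (0 <= level_count l S) by (apply lsum_nonneg; intros; destruct (_ && _)%bool; lra).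
  assert (0 < / eta) by now apply Rinv_0_lt_compat.
  assert (0 <= / eta * devsq S) by (apply Rmult_le_pos; lra). nra.
Qed.

(** Elements stopping at [S] pay their own deviation from [bias S]. For the others the triangle
    inequality changes the reference from [bias S] to the bias of the next set, at the price of the
    drift. As long as [S] is not heavy, its mass is at most [K / 2 ^ l], which scales both costs. *)
Lemma surviving_bias_le (k l : nat) (S : nat -> bool) :
  lsum (dom n) (fun i => Rabs (d i - m i * bias S) * surv i k l S) <=
  K / 2 ^ l * chain_sum n chain_cost k l S.
Proof.
  assert (HE := Ehalf_expectation n).
  revert l S; induction k as [|k IH]; intros l S; cbn [chain_sum surv].
  { rewrite (lsum_ext _ _ (fun _ => 0)), lsum_const by (intros; ring). lra. }
  assert (Hp : 0 < 2 ^ l) by (apply pow_lt; lra).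
  assert (Hc : 0 <= chain_cost l S + Ehalf n (fun B => chain_sum n chain_cost k (Datatypes.S l) (inter S B))).
  { apply Rplus_le_le_0_compat; [apply chain_cost_nonneg|].
    apply (ex_nonneg HE). intros B. apply chain_sum_nonneg, chain_cost_nonneg. }
  assert (HKp : 0 < K / 2 ^ l) by now apply Rdiv_lt_0_compat.
  destruct (Rle_dec _ _) as [Hg|Hg].
  2:{ rewrite (lsum_ext _ _ (fun _ => 0)), lsum_const by (intros; ring).
      rewrite Rmult_0_r. apply Rmult_le_pos; lra. }
  assert (HM : 0 <= mass n m S) by (apply mass_nonneg, m_nonneg).
  set (c := fun i B => surv i k (Datatypes.S l) (inter S B)).
  assert (Hcb : forall i B, (1 <= i <= n)%nat -> 0 <= c i B <= if inter S B i then 1 else 0).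
  { intros i B Hi. pose proof (surv_bounds i k (Datatypes.S l) (inter S B) Hi) as Hb.
    unfold c. destruct (inter S B i), (Nat.leb (Datatypes.S l) (lev i)); cbn [andb] in Hb; lra. }
  (* [amgm] is applied to each stopping element separately, so [eta / 2] is paid once per element;
     this is where [level_count] comes from. *)
  assert (Hnow : lsum (dom n) (fun i => Rabs (d i - m i * bias S) *
      (if (S i && Nat.eqb (lev i) l)%bool then 1 else 0)) <=
      mass n m S * (eta / 2 * level_count l S + / (2 * eta) * devsq S)).
  { unfold level_count, devsq. rewrite <- !lsum_scal, <- lsum_plus, <- lsum_scal.
    apply lsum_le. intros i Hi. apply in_seq in Hi.
    assert (Hsq : 0 <= / (2 * eta) * (dev S i * dev S i)).
    { apply Rmult_le_pos; [left; apply Rinv_0_lt_compat; lra|apply Rle_0_sqr]. }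
    destruct (S i) eqn:HS; cbn [andb]; [|nra].
    destruct (Nat.eqb (lev i) l); [|nra].
    rewrite <- mass_dev, Rabs_mult, (Rabs_pos_eq (mass n m S)) by (lia || assumption).
    rewrite !Rmult_1_r. apply Rmult_le_compat_l; [assumption|].
    eapply Rle_trans; [apply amgm|]. right. field. lra. }
  (* The survivors lie in [inter S B], so the total weight on the change of reference is at most the
     mass of that set. *)
  assert (Hlater : forall B, lsum (dom n) (fun i => Rabs (d i - m i * bias S) * c i B) <=
      K / 2 ^ Datatypes.S l * chain_sum n chain_cost k (Datatypes.S l) (inter S B) +
      mass n m (inter S B) * Rabs (bias (inter S B) - bias S)).
  { intros B. eapply Rle_trans; [|apply Rplus_le_compat_r, IH]. fold (c : nat -> list bool -> R).
    unfold mass at 1. rewrite sumR_lsum, Rmult_comm, <- lsum_scal, <- lsum_plus.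
    apply lsum_le. intros i Hi. apply in_seq in Hi.
    assert (Hi' : (1 <= i <= n)%nat) by lia.
    pose proof (Hcb i B Hi') as Hb. change (surv i k (Datatypes.S l) (inter S B)) with (c i B).
    assert (Htri : Rabs (d i - m i * bias S) <=
      Rabs (d i - m i * bias (inter S B)) + m i * Rabs (bias (inter S B) - bias S)).
    { rewrite <- (Rabs_pos_eq (m i)) at 3 by now apply m_nonneg.
      rewrite <- Rabs_mult. eapply Rle_trans; [|apply Rabs_triang]. right. f_equal. ring. }
    pose proof (Rabs_pos (bias (inter S B) - bias S)) as Hr. pose proof (m_nonneg i Hi') as Hm.
    assert (0 <= m i * Rabs (bias (inter S B) - bias S)) by now apply Rmult_le_pos.
    destruct (inter S B i); nra. }
  rewrite (lsum_ext _ _ (fun i =>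
    Rabs (d i - m i * bias S) * (if (S i && Nat.eqb (lev i) l)%bool then 1 else 0) +
    2 * Ehalf n (fun B => Rabs (d i - m i * bias S) * c i B))).
  2:{ intros i _. rewrite (ex_scal _ HE (Rabs (d i - m i * bias S)) (c i)). unfold c. ring. }
  rewrite lsum_plus, lsum_scal, <- (ex_lsum HE).
  eapply Rle_trans.
  { apply Rplus_le_compat; [exact Hnow|]. apply Rmult_le_compat_l; [lra|].
    apply (ex_le _ HE). exact Hlater. }
  rewrite (ex_plus _ HE), (ex_scal _ HE). pose proof (Ehalf_bias_drift S) as Hdr.
  assert (Hcost : mass n m S * chain_cost l S <= K / 2 ^ l * chain_cost l S)
    by (apply Rmult_le_compat_r; [apply chain_cost_nonneg|assumption]).
  set (T := Ehalf n (fun B => chain_sum n chain_cost k (Datatypes.S l) (inter S B))) in *.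
  (* The 2 from the definition of [surv] turns the bound of level [l + 1] back into that of level
     [l]. *)
  replace (2 * (K / 2 ^ Datatypes.S l * T + _)) with (K / 2 ^ l * T +
    2 * Ehalf n (fun B => mass n m (inter S B) * Rabs (bias (inter S B) - bias S)))
    by (cbn [pow]; field; lra).
  assert (Hsplit : mass n m S * chain_cost l S =
    mass n m S * (eta / 2 * level_count l S + / (2 * eta) * devsq S) +
    mass n m S * (eta / 2 + devsq S / (2 * eta))) by (unfold chain_cost; field; lra).
  lra.
Qed.

End Chain.

(** * Dyadic levels of the elements *)

Fixpoint dyadic_level (x : R) (J : nat) : nat :=
  match J with
  | O => O
  | S J' => if Rle_dec (2 ^ J * x) 1 then J else dyadic_level x J'
  end.

Lemma dyadic_level_le (x : R) (J : nat) : (dyadic_level x J <= J)%nat.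
Proof. induction J as [|J IH]; simpl; [lia|]. destruct (Rle_dec _ _); lia. Qed.

Lemma dyadic_level_mul (x : R) (J : nat) : x <= 1 -> 2 ^ dyadic_level x J * x <= 1.
Proof.
  intros Hx. induction J as [|J IH]; cbn [dyadic_level]; [simpl; lra|].
  destruct (Rle_dec _ _); assumption.
Qed.

(** Below the cap [J] the next level already violates [2 ^ j * x <= 1]; the term [/ 2 ^ J] covers
    elements too light to be resolved, and adds up to at most 1 over [[n]] if [n <= 2 ^ J]. *)
Lemma dyadic_level_inv (x : R) (J : nat) :
  0 <= x -> / 2 ^ dyadic_level x J <= 2 * x + / 2 ^ J.
Proof.
  intros Hx.
  enough (dyadic_level x J = J \/ / 2 ^ dyadic_level x J <= 2 * x) as [->|H].
  - lra.
  - assert (0 < / 2 ^ J) by (apply Rinv_0_lt_compat, pow_lt; lra). lra.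
  - induction J as [|J IH]; [now left|]. cbn [dyadic_level].
    destruct (Rle_dec _ _) as [H|H]; [now left|]. right.
    destruct IH as [->|IH]; [|assumption].
    assert (Hp : 0 < 2 ^ J) by (apply pow_lt; lra). cbn [pow] in H.
    apply Rmult_le_reg_l with (2 ^ J); [assumption|]. rewrite Rinv_r by lra. lra.
Qed.

(** * Conditional probabilities and their gaps *)

Definition hit (n : nat) (p : nat -> R) (S T : nat -> bool) : R :=
  lsum (dom n) (fun i => if T i then cond_prob n p S i else 0).

(** For consecutive sets of a chain this is the difference [D_l] of the opening sketch. *)
Definition gap (n : nat) (p q : nat -> R) (S T : nat -> bool) : R :=
  hit n p S T - hit n q S T.

Lemma hit_inter (n : nat) (p : nat -> R) (S : nat -> bool) (B : list bool) :
  hit n p S (inter S B) = lin n (cond_prob n p S) B.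
Proof.
  apply lsum_ext. intros i _. unfold inter, cond_prob. destruct (S i), (bit B i); reflexivity.
Qed.

Lemma card_set_lsum (n : nat) (S : nat -> bool) :
  INR (card_set n S) = lsum (dom n) (fun i => if S i then 1 else 0).
Proof.
  unfold card_set. induction (dom n) as [|i l IH]; [reflexivity|].
  simpl. destruct (S i); [cbn [length]; rewrite S_INR, IH; lra|rewrite IH; lra].
Qed.

Lemma card_set_pos (n : nat) (S : nat -> bool) : nonempty_in n S -> 0 < INR (card_set n S).
Proof.
  intros [i [Hi HS]]. rewrite card_set_lsum.
  pose proof (lsum_term_le (dom n) (fun i => if S i then 1 else 0) i) as H.
  cbv beta in H. rewrite HS in H. apply Rlt_le_trans with 1; [lra|]. apply H.
  - intros y _. destruct (S y); lra.
  - apply in_seq. lia.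
Qed.

Lemma cond_prob_nonneg (n : nat) (p : nat -> R) (S : nat -> bool) (i : nat) :
  is_distr n p -> nonempty_in n S -> In i (dom n) -> 0 <= cond_prob n p S i.
Proof.
  intros [Hp _] HS Hi. apply in_seq in Hi. unfold cond_prob.
  destruct (S i); [|lra]. destruct (Req_EM_T _ _) as [_|H0].
  - left. apply Rinv_0_lt_compat. now apply card_set_pos.
  - pose proof (mass_nonneg n p S Hp). apply Rmult_le_pos; [apply Hp; lia|].
    left. apply Rinv_0_lt_compat. lra.
Qed.

Lemma cond_prob_total (n : nat) (p : nat -> R) (S : nat -> bool) :
  nonempty_in n S -> lsum (dom n) (cond_prob n p S) = 1.
Proof.
  intros HS. unfold cond_prob. destruct (Req_EM_T _ _) as [_|H0].
  - rewrite (lsum_ext _ _ (fun i => / INR (card_set n S) * (if S i then 1 else 0)))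
      by (intros i _; destruct (S i); ring).
    rewrite lsum_scal, <- card_set_lsum. apply Rinv_l.
    pose proof (card_set_pos n S HS). lra.
  - rewrite (lsum_ext _ _ (fun i => / mass n p S * (if S i then p i else 0)))
      by (intros i _; destruct (S i); unfold Rdiv; ring).
    rewrite lsum_scal. change (lsum (dom n) (fun i => if S i then p i else 0)) with (mass n p S).
    now apply Rinv_l.
Qed.

Lemma existsb_nonempty_in (n : nat) (S : nat -> bool) :
  existsb S (dom n) = true <-> nonempty_in n S.
Proof.
  rewrite existsb_exists. unfold nonempty_in, dom.
  split; intros [i [Hi HS]]; exists i; split; try assumption; apply in_seq || apply in_seq in Hi; lia.
Qed.

(** Both totals are 1 on a nonempty set and 0 on an empty one, which random halving can produce. *)
Lemma cond_prob_total_eq (n : nat) (p q : nat -> R) (S : nat -> bool) :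
  lsum (dom n) (cond_prob n p S) = lsum (dom n) (cond_prob n q S).
Proof.
  destruct (existsb S (dom n)) eqn:He.
  - apply existsb_nonempty_in in He. now rewrite !cond_prob_total.
  - apply lsum_ext. intros i Hi. unfold cond_prob. destruct (S i) eqn:HS; [|reflexivity].
    assert (existsb S (dom n) = true) by (apply existsb_exists; eauto). congruence.
Qed.

(** The gap is a linear form whose coefficients sum to 0, so only the diagonal part of
    [Ehalf_lin_lin] is left. *)
Lemma Ehalf_gap (n : nat) (p q : nat -> R) (S : nat -> bool) :
  Ehalf n (fun B => gap n p q S (inter S B) * gap n p q S (inter S B)) =
  / 4 * lsum (dom n) (fun i => (cond_prob n p S i - cond_prob n q S i) *
                               (cond_prob n p S i - cond_prob n q S i)).
Proof.
  set (x := fun i => cond_prob n p S i - cond_prob n q S i).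
  rewrite (ex_ext (Ehalf_expectation n) _ (fun B => lin n x B * lin n x B)).
  - assert (Hx : lsum (dom n) x = 0)
      by (unfold x; rewrite lsum_minus; apply Rminus_diag_eq, cond_prob_total_eq).
    rewrite Ehalf_lin_lin, Hx. unfold x. ring.
  - intros B. unfold gap. rewrite !hit_inter.
    assert (lin n (cond_prob n p S) B - lin n (cond_prob n q S) B = lin n x B) as ->.
    { unfold lin. rewrite <- lsum_minus. apply lsum_ext. intros i _.
      unfold x. destruct (bit B i); ring. }
    reflexivity.
Qed.

(** * The energy inequality *)

Section Energy.
Context (n : nat) (p q : nat -> R) (Hp : is_distr n p) (Hq : is_distr n q).

Let m (i : nat) : R := (p i + q i) / 2.
Let d (i : nat) : R := (p i - q i) / 2.

Lemma half_diff_le_half_sum (i : nat) : (1 <= i <= n)%nat -> Rabs (d i) <= m i.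
Proof.
  intros Hi. destruct Hp as [Hp0 _], Hq as [Hq0 _].
  pose proof (Hp0 i Hi). pose proof (Hq0 i Hi).
  apply Rabs_le. unfold m, d. lra.
Qed.

Lemma mass_half_sum (S : nat -> bool) : mass n m S = (mass n p S + mass n q S) / 2.
Proof.
  transitivity (/ 2 * (mass n p S + mass n q S)); [|lra].
  unfold mass. rewrite sumR_lsum, <- lsum_plus, <- lsum_scal.
  apply lsum_ext. intros i _. unfold m. destruct (S i); field.
Qed.

Lemma mass_half_diff (S : nat -> bool) : mass n d S = (mass n p S - mass n q S) / 2.
Proof.
  transitivity (/ 2 * (mass n p S - mass n q S)); [|lra].
  unfold mass. rewrite sumR_lsum, <- lsum_minus, <- lsum_scal.
  apply lsum_ext. intros i _. unfold d. destruct (S i); field.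
Qed.

(** With [a] and [b] the masses of [S] under [p] and [q], [dev S i] equals [/ 2 * u * r], where [u]
    is the difference of conditional probabilities and [r = 4ab / (a + b)^2] is at most 1. If a mass
    is zero, [dev] vanishes, so the oracle's uniform default does no harm. *)
Lemma devsq_le_gap (S : nat -> bool) :
  devsq n m d S <= Ehalf n (fun B => gap n p q S (inter S B) * gap n p q S (inter S B)).
Proof.
  rewrite Ehalf_gap. unfold devsq. rewrite <- lsum_scal. apply lsum_le.
  intros i Hi. apply in_seq in Hi. destruct Hp as [Hp0 _], Hq as [Hq0 _].
  unfold dev, bias, cond_prob. destruct (S i) eqn:HS; [|lra].
  assert (Hi' : (1 <= i <= n)%nat) by lia.
  pose proof (mass_ge_term n p S i Hp0 Hi' HS) as Hpi.
  pose proof (mass_ge_term n q S i Hq0 Hi' HS) as Hqi.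
  pose proof (Hp0 i Hi'). pose proof (Hq0 i Hi').
  rewrite mass_half_sum, mass_half_diff. unfold m, d.
  set (a := mass n p S) in *. set (b := mass n q S) in *.
  assert (Hnn : forall x, 0 * 0 <= / 4 * (x * x))
    by (intros x; pose proof (Rle_0_sqr x) as Hs; unfold Rsqr in Hs; lra).
  destruct (Req_dec a 0) as [Ha|Ha]; [|destruct (Req_dec b 0) as [Hb|Hb]].
  - assert (p i = 0) as Hpi0 by lra.
    match goal with |- ?x * ?x <= _ => assert (x = 0) as ->; [|now apply Hnn] end.
    destruct (Req_dec b 0) as [Hb|Hb].
    + rewrite Ha, Hb. replace ((0 + 0) / 2) with 0 by lra. unfold Rdiv. rewrite Rinv_0. ring.
    + rewrite Ha, Hpi0. field. lra.
  - assert (q i = 0) as Hqi0 by lra.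
    match goal with |- ?x * ?x <= _ => assert (x = 0) as ->; [|now apply Hnn] end.
    rewrite Hb, Hqi0. field. lra.
  - destruct (Req_EM_T a 0); [contradiction|]. destruct (Req_EM_T b 0); [contradiction|].
    assert (0 < a) by lra. assert (0 < b) by lra.
    set (u := p i / a - q i / b).
    set (r := 4 * (a * b) / ((a + b) * (a + b))).
    replace (((p i - q i) / 2 - (p i + q i) / 2 * ((a - b) / 2 / ((a + b) / 2))) / ((a + b) / 2))
      with (/ 2 * u * r) by (unfold u, r; field; lra).
    assert (Hab : 0 < (a + b) * (a + b)) by nra.
    assert (Hr : 0 <= r <= 1).
    { unfold r. split.
      - apply Rmult_le_pos; [nra|left; now apply Rinv_0_lt_compat].
      - apply Rmult_le_reg_r with ((a + b) * (a + b)); [assumption|].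
        unfold Rdiv. rewrite Rmult_assoc, Rinv_l by lra.
        pose proof (Rle_0_sqr (a - b)) as Hs. unfold Rsqr in Hs. lra. }
    replace (/ 2 * u * r * (/ 2 * u * r)) with (/ 4 * (u * u) * (r * r)) by field.
    pose proof (Rle_0_sqr u) as Hu. unfold Rsqr in Hu.
    assert (r * r <= 1) by nra.
    rewrite <- (Rmult_1_r (/ 4 * (u * u))) at 2. apply Rmult_le_compat_l; lra.
Qed.

Lemma chain_energy (J : nat) (eps : R) :
  INR n <= 2 ^ J -> 0 < eps <= dTV n p q ->
  eps ^ 2 / (512 * INR (S J) ^ 3) <=
  chain_sum n (fun _ S => Ehalf n (fun B => gap n p q S (inter S B) * gap n p q S (inter S B)))
    (S J) 0 (fun _ => true).
Proof.
  intros HJ [Heps HTV].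
  set (full := fun _ : nat => true). set (N := INR (S J)).
  assert (HN : 1 <= N) by (unfold N; rewrite S_INR; pose proof (pos_INR J); lra).
  (* [K] leaves survival probability at least 1/2: at most [N] levels, each failing with probability
     at most [2 / K]. [eta] makes the terms without [devsq] cost at most [eps / 4], half of the
     lower bound [eps / 2]. *)
  set (K := 4 * N). set (eta := eps / (8 * K * N)). set (lev := fun i => dyadic_level (m i) J).
  assert (HK : 0 < K) by (unfold K; lra).
  assert (Heta : 0 < eta) by (apply Rdiv_lt_0_compat; nra).
  assert (Hd := half_diff_le_half_sum).
  assert (Hfullp : mass n p full = 1) by apply Hp.
  assert (Hfullq : mass n q full = 1) by apply Hq.
  assert (Hm0 : forall i, (1 <= i <= n)%nat -> 0 <= m i)
    by (intros i Hi; eapply Rle_trans; [apply Rabs_pos|now apply Hd]).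
  assert (Hm1 : forall i, (1 <= i <= n)%nat -> m i <= 1).
  { intros i Hi. pose proof (mass_ge_term n m full i Hm0 Hi eq_refl) as H.
    rewrite mass_half_sum, Hfullp, Hfullq in H. lra. }
  (* The bias of the full set is 0, so the deviations are [Rabs (d i)], whose sum is the total
     variation distance; survival costs a factor 2. *)
  assert (Hlow : eps / 2 <= lsum (dom n) (fun i =>
    Rabs (d i - m i * bias n m d full) * surv n m lev K i (S J) 0 full)).
  { apply Rle_trans with (/ 2 * dTV n p q); [lra|]. unfold dTV.
    rewrite sumR_lsum, <- !lsum_scal. apply lsum_le. intros i Hi. apply in_seq in Hi.
    assert (Hi' : (1 <= i <= n)%nat) by lia.
    assert (Hlev : (lev i <= J)%nat) by apply dyadic_level_le.
    pose proof (surv_lower n m d Hd lev K HK i (S J) 0 full Hi' eq_refl ltac:(lia)) as Hs.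
    assert (Hb : bias n m d full = 0).
    { unfold bias. rewrite mass_half_diff, Hfullp, Hfullq. unfold Rdiv. ring. }
    rewrite Hb, Rmult_0_r, Rminus_0_r. unfold d at 1. unfold Rdiv.
    rewrite Rabs_mult, (Rabs_pos_eq (/ 2)) by lra.
    assert (/ 2 <= surv n m lev K i (S J) 0 full).
    { eapply Rle_trans; [|exact Hs]. rewrite mass_half_sum, Hfullp, Hfullq.
      replace (lev i + 1 - 0)%nat with (S (lev i)) by lia.
      assert (HNle : INR (S (lev i)) <= N) by (apply le_INR; lia).
      assert (Hdy : 2 ^ lev i * m i <= 1) by (apply dyadic_level_mul; auto).
      pose proof (Hm0 i Hi').
      assert (Hfrac : 0 <= INR (S (lev i)) / K <= / 4).
      { split; [apply Rmult_le_pos; [apply pos_INR|left; now apply Rinv_0_lt_compat]|].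
        apply Rmult_le_reg_r with K; [assumption|].
        unfold Rdiv. rewrite Rmult_assoc, Rinv_l by lra. unfold K. lra. }
      rewrite pow_O. set (f := INR (S (lev i)) / K) in *.
      set (y := (2 ^ lev i - 1) * m i + 1 * ((1 + 1) / 2)).
      assert (y <= 2) by (unfold y; lra).
      assert (f * y <= f * 2) by (apply Rmult_le_compat_l; lra). lra. }
    pose proof (Rabs_pos (p i - q i)). nra. }
  assert (Hup := surviving_bias_le n m d Hd lev K eta HK Heta (S J) 0 full).
  rewrite pow_O in Hup.
  unfold chain_cost in Hup.
  rewrite (chain_sum_plus n (fun l S => eta / 2 * level_count n lev l S)
    (fun l S => eta / 2 + / eta * devsq n m d S)) in Hup.
  rewrite (chain_sum_plus n (fun l S => eta / 2) (fun l S => / eta * devsq n m d S)) in Hup.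
  rewrite (chain_sum_scal n (eta / 2) (level_count n lev)) in Hup.
  rewrite (chain_sum_scal n (/ eta) (fun _ S => devsq n m d S)) in Hup.
  rewrite chain_sum_const in Hup. fold N in Hup.
  (* 2 from the total mass of [m], and 1 from the cap on the levels. *)
  assert (Hcnt : chain_sum n (level_count n lev) (S J) 0 full <= 3).
  { eapply Rle_trans; [apply chain_sum_level_count|].
    apply Rle_trans with (lsum (dom n) (fun i => 2 * m i + / 2 ^ J)).
    - apply lsum_le. intros i Hi. apply in_seq in Hi. cbn [full andb Nat.leb].
      unfold Rdiv. rewrite pow_O, Rmult_1_l. apply dyadic_level_inv. apply Hm0. lia.
    - rewrite lsum_plus, lsum_scal, lsum_const. unfold dom at 2. rewrite length_seq.
      change (lsum (dom n) m) with (mass n m full). rewrite mass_half_sum, Hfullp, Hfullq.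
      assert (INR n * / 2 ^ J <= 1).
      { assert (0 < 2 ^ J) by (apply pow_lt; lra).
        apply Rmult_le_reg_r with (2 ^ J); [assumption|].
        rewrite Rmult_assoc, Rinv_l by lra. lra. }
      lra. }
  assert (Hdev := chain_sum_le n _ _ (S J) 0 full (fun _ S => devsq_le_gap S)).
  set (T := chain_sum n (fun _ S => Ehalf n _) (S J) 0 full) in *.
  set (V := chain_sum n (fun _ S => devsq n m d S) (S J) 0 full) in *.
  assert (Hie : 0 < / eta) by now apply Rinv_0_lt_compat.
  assert (Hmain : eps / 4 <= K * (/ eta * T)).
  { assert (eta / 2 * chain_sum n (level_count n lev) (S J) 0 full <= eta / 2 * 3)
      by (apply Rmult_le_compat_l; lra).
    assert (/ eta * V <= / eta * T) by (apply Rmult_le_compat_l; lra).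
    assert (HKe : K * (eta * (2 * N)) = eps / 4) by (unfold eta; field; lra).
    assert (Hb : K / 1 * (eta / 2 * chain_sum n (level_count n lev) (S J) 0 full +
       (N * (eta / 2) + / eta * V)) <= K * (eta * (2 * N) + / eta * T)).
    { unfold Rdiv at 1. rewrite Rinv_1, Rmult_1_r. apply Rmult_le_compat_l; [lra|]. nra. }
    lra. }
  apply Rle_trans with (eps / 4 * (eta / K)).
  - right. unfold eta, K. field. lra.
  - apply Rle_trans with (K * (/ eta * T) * (eta / K)).
    + apply Rmult_le_compat_r; [left; now apply Rdiv_lt_0_compat|assumption].
    + right. field. lra.
Qed.

End Energy.
(** * Joining independent tests into one non-adaptive tester *)

Lemma exp_answers_expectation (n : nat) (p : nat -> R) (Qs : list (nat -> bool)) :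
  is_distr n p -> Forall (nonempty_in n) Qs -> expectation (exp_answers n p Qs).
Proof.
  intros Hp HQ. induction HQ as [|S Qs HS HQ IH].
  - split; simpl; auto.
  - split; simpl; rewrite ?sumR_lsum; intros.
    + rewrite <- lsum_plus. apply lsum_ext. intros i _. rewrite (ex_plus _ IH). ring.
    + rewrite <- lsum_scal. apply lsum_ext. intros i _. rewrite (ex_scal _ IH). ring.
    + apply lsum_le. intros i Hi. apply Rmult_le_compat_l; [now apply cond_prob_nonneg|].
      apply (ex_le _ IH). auto.
    + rewrite (lsum_ext _ _ (cond_prob n p S)); [now apply cond_prob_total|].
      intros i _. rewrite (ex_one _ IH). ring.
Qed.

(** Agreement on answer lists of the right length suffices; this lets [accept_verdict] cut
    concatenated answers by length. *)
Lemma exp_answers_ext (n : nat) (p : nat -> R) (Qs : list (nat -> bool)) (f g : list nat -> R) :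
  (forall a, length a = length Qs -> f a = g a) -> exp_answers n p Qs f = exp_answers n p Qs g.
Proof.
  revert f g; induction Qs as [|S Qs IH]; intros f g H; simpl; [now apply H|].
  rewrite sumR_lsum. apply lsum_ext. intros i _. f_equal. apply IH.
  intros a Ha. apply H. simpl. now f_equal.
Qed.

Lemma exp_answers_app (n : nat) (p : nat -> R) (Qs Qs' : list (nat -> bool)) (f : list nat -> R) :
  exp_answers n p (Qs ++ Qs') f =
  exp_answers n p Qs (fun a => exp_answers n p Qs' (fun a' => f (a ++ a'))).
Proof.
  revert f; induction Qs as [|S Qs IH]; intros f; simpl; [reflexivity|].
  rewrite sumR_lsum. apply lsum_ext. intros i _. f_equal. apply IH.
Qed.

Definition Epq (n : nat) (p q : nat -> R) (Qs : list (nat -> bool))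
    (f : list nat * list nat -> R) : R :=
  exp_answers n p Qs (fun ap => exp_answers n q Qs (fun aq => f (ap, aq))).

Lemma Epq_expectation (n : nat) (p q : nat -> R) (Qs : list (nat -> bool)) :
  is_distr n p -> is_distr n q -> Forall (nonempty_in n) Qs -> expectation (Epq n p q Qs).
Proof.
  intros Hp Hq HQ.
  assert (HEp := exp_answers_expectation n p Qs Hp HQ).
  assert (HEq := exp_answers_expectation n q Qs Hq HQ).
  unfold Epq. split; intros.
  - rewrite <- (ex_plus _ HEp). apply (ex_ext HEp). intros. apply (ex_plus _ HEq).
  - rewrite <- (ex_scal _ HEp). apply (ex_ext HEp). intros. apply (ex_scal _ HEq).
  - apply (ex_le _ HEp). intros. apply (ex_le _ HEq). auto.
  - rewrite (ex_ext HEp _ (fun _ => 1)); [apply (ex_one _ HEp)|]. intros. apply (ex_one _ HEq).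
Qed.

Definition test : Type := list (nat -> bool) * (list nat -> list nat -> bool).

Definition accept (n : nat) (p q : nat -> R) (t : test) : R :=
  Epq n p q (fst t) (fun a => if snd t (fst a) (snd a) then 1 else 0).

Definition queries (ts : list test) : list (nat -> bool) := flat_map fst ts.

Fixpoint verdict (ts : list test) (ap aq : list nat) : bool :=
  match ts with
  | [] => true
  | t :: ts' =>
      let k := length (fst t) in
      (snd t (firstn k ap) (firstn k aq) && verdict ts' (skipn k ap) (skipn k aq))%bool
  end.

(** With the query sets fixed, all answers are independent, so the tests accept jointly with the
    product of their acceptance probabilities. *)
Lemma accept_verdict (n : nat) (p q : nat -> R) (ts : list test) :
  is_distr n p -> is_distr n q -> Forall (nonempty_in n) (queries ts) ->
  Epq n p q (queries ts) (fun a => if verdict ts (fst a) (snd a) then 1 else 0) =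
  lprod ts (accept n p q).
Proof.
  intros Hp Hq. induction ts as [|[Q o] ts IH]; intros HQ; [reflexivity|].
  cbn [queries flat_map fst] in HQ. apply Forall_app in HQ as [HQ1 HQ2].
  specialize (IH HQ2). simpl lprod. rewrite <- IH.
  assert (HEp := exp_answers_expectation n p Q Hp HQ1).
  assert (HEq := exp_answers_expectation n q Q Hq HQ1).
  assert (HEp' := exp_answers_expectation n p (queries ts) Hp HQ2).
  assert (HEq' := exp_answers_expectation n q (queries ts) Hq HQ2).
  change (queries ((Q, o) :: ts)) with (Q ++ queries ts).
  unfold accept, Epq. cbn [fst snd].
  rewrite exp_answers_app, (Rmult_comm (exp_answers n p Q _)), <- (ex_scal _ HEp).
  apply exp_answers_ext. intros ap Hap.
  rewrite (Rmult_comm (exp_answers n p (queries ts) _)), <- (ex_scal _ HEp').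
  apply exp_answers_ext. intros ap' _.
  rewrite exp_answers_app, (Rmult_comm (exp_answers n q Q _)), <- (ex_scal _ HEq).
  apply exp_answers_ext. intros aq Haq.
  rewrite (Rmult_comm (exp_answers n q (queries ts) _)), <- (ex_scal _ HEq').
  apply exp_answers_ext. intros aq' _.
  cbn [verdict fst snd].
  assert (Hsplit : forall a a' : list nat, length a = length Q ->
    firstn (length Q) (a ++ a') = a /\ skipn (length Q) (a ++ a') = a').
  { intros a a' <-. rewrite firstn_app, skipn_app, Nat.sub_diag, firstn_all, skipn_all.
    cbn [firstn skipn]. now rewrite app_nil_r. }
  destruct (Hsplit ap ap' Hap) as [-> ->], (Hsplit aq aq' Haq) as [-> ->].
  destruct (o ap aq), (verdict ts ap' aq'); simpl; ring.
Qed.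

(** * Testing one halving step *)

Lemma exp_le_mono (x y : R) : x <= y -> exp x <= exp y.
Proof. intros [H| ->]; [left; now apply exp_increasing|lra]. Qed.

Lemma exp_ge_1 (x : R) : 0 <= x -> 1 <= exp x.
Proof. intros Hx. rewrite <- exp_0. now apply exp_le_mono. Qed.

(** From [exp (- t) >= 1 - t] one gets [exp t * (1 - t) <= 1], and [(1 + t + 2 * t ^ 2) * (1 - t) =
    1 + t ^ 2 * (1 - 2 * t)]. *)
Lemma exp_le_quadratic (t : R) : t <= / 2 -> exp t <= 1 + t + 2 * t ^ 2.
Proof.
  intros Ht. pose proof (exp_ineq1_le (- t)) as H. pose proof (exp_pos t) as Hp.
  assert (Hinv : exp t * exp (- t) = 1) by (rewrite <- exp_plus, Rplus_opp_r; apply exp_0).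
  assert (H1 : exp t * (1 - t) <= 1) by nra.
  apply Rmult_le_reg_r with (1 - t); [lra|].
  assert (0 <= t ^ 2 * (1 - 2 * t)) by (apply Rmult_le_pos; [apply pow2_ge_0|lra]). nra.
Qed.

Lemma pow_1_plus_le_exp (x : R) (N : nat) : 0 <= 1 + x -> (1 + x) ^ N <= exp (INR N * x).
Proof.
  intros Hx. induction N as [|N IH]; [simpl; rewrite Rmult_0_l, exp_0; lra|].
  replace (INR (S N) * x) with (x + INR N * x) by (rewrite S_INR; ring).
  rewrite exp_plus. cbn [pow].
  apply Rmult_le_compat; [assumption|now apply pow_le|apply exp_ineq1_le|assumption].
Qed.

Definition hits (T : nat -> bool) (a : list nat) : R :=
  lsum a (fun i => if T i then 1 else 0).

Lemma hit_empty (n : nat) (p : nat -> R) (S T : nat -> bool) :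
  existsb S (dom n) = false -> hit n p S T = 0.
Proof.
  intros HS. unfold hit. rewrite (lsum_ext _ _ (fun _ => 0)), lsum_const; [lra|].
  intros i Hi. unfold cond_prob. destruct (S i) eqn:HSi; [|now destruct (T i)].
  assert (existsb S (dom n) = true) by (apply existsb_exists; eauto). congruence.
Qed.

Lemma hit_bounds (n : nat) (p : nat -> R) (S T : nat -> bool) :
  is_distr n p -> nonempty_in n S -> 0 <= hit n p S T <= 1.
Proof.
  intros Hp HS. unfold hit. split.
  - apply lsum_nonneg. intros i Hi. pose proof (cond_prob_nonneg n p S i Hp HS Hi).
    destruct (T i); lra.
  - rewrite <- (cond_prob_total n p S HS). apply lsum_le. intros i Hi.
    pose proof (cond_prob_nonneg n p S i Hp HS Hi). destruct (T i); lra.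
Qed.

Lemma forall_repeat {X : Type} (P : X -> Prop) (x : X) (N : nat) : P x -> Forall P (repeat x N).
Proof. intros H. induction N; simpl; auto. Qed.

Lemma hits_mgf (n : nat) (p : nat -> R) (S T : nat -> bool) (N : nat) (t : R) :
  is_distr n p -> nonempty_in n S ->
  exp_answers n p (repeat S N) (fun a => exp (t * hits T a)) =
  (1 + hit n p S T * (exp t - 1)) ^ N.
Proof.
  intros Hp HS. induction N as [|N IH].
  - simpl. rewrite Rmult_0_r. apply exp_0.
  - assert (HE := exp_answers_expectation n p (repeat S N) Hp (forall_repeat _ _ _ HS)).
    cbn [repeat exp_answers pow]. rewrite sumR_lsum, <- IH.
    set (M := exp_answers n p (repeat S N) _).
    rewrite (lsum_ext _ _ (fun i => M * (cond_prob n p S i +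
      (exp t - 1) * (if T i then cond_prob n p S i else 0)))).
    + rewrite lsum_scal, lsum_plus, lsum_scal, (cond_prob_total n p S HS).
      fold (hit n p S T). ring.
    + intros i _. rewrite (ex_ext HE _ (fun a => exp (t * (if T i then 1 else 0)) * exp (t * hits T a))).
      * rewrite (ex_scal _ HE). fold M. destruct (T i).
        -- rewrite Rmult_1_r. ring.
        -- rewrite Rmult_0_r, exp_0. ring.
      * intros a. rewrite <- exp_plus. f_equal. unfold hits. simpl. ring.
Qed.

(** The Chernoff bound for two independent binomial counts; each contributes [2 * t ^ 2] per sample
    by [exp_le_quadratic]. *)
Lemma hits_diff_mgf (n : nat) (p q : nat -> R) (S T : nat -> bool) (N : nat) (t : R) :
  is_distr n p -> is_distr n q -> nonempty_in n S -> - / 2 <= t <= / 2 ->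
  Epq n p q (repeat S N) (fun a => exp (t * (hits T (fst a) - hits T (snd a)))) <=
  exp (INR N * (t * gap n p q S T + 4 * t ^ 2)).
Proof.
  intros Hp Hq HS Ht. assert (HQ := forall_repeat _ _ N HS).
  assert (HEp := exp_answers_expectation n p _ Hp HQ).
  assert (HEq := exp_answers_expectation n q _ Hq HQ).
  unfold Epq. cbn [fst snd].
  set (P := hit n p S T). set (Q := hit n q S T).
  assert (HP : 0 <= P <= 1) by now apply hit_bounds.
  assert (HQ' : 0 <= Q <= 1) by now apply hit_bounds.
  rewrite (ex_ext HEp _ (fun a => (1 + Q * (exp (- t) - 1)) ^ N * exp (t * hits T a))).
  2:{ intros a. unfold Q. rewrite <- (hits_mgf n q S T N (- t) Hq HS), Rmult_comm, <- (ex_scal _ HEq).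
      apply (ex_ext HEq). intros a'. rewrite <- exp_plus. f_equal. ring. }
  rewrite (ex_scal _ HEp), hits_mgf by assumption. fold P.
  assert (Hstep : forall P s, 0 <= P <= 1 -> s <= / 2 ->
    0 <= (1 + P * (exp s - 1)) ^ N <= exp (INR N * (P * s + 2 * s ^ 2))).
  { intros P' s HP' Hs. pose proof (exp_pos s) as Hpos.
    assert (H0 : 0 <= 1 + P' * (exp s - 1)) by nra.
    split; [now apply pow_le|].
    eapply Rle_trans; [now apply pow_1_plus_le_exp|].
    apply exp_le_mono, Rmult_le_compat_l; [apply pos_INR|].
    pose proof (exp_le_quadratic s Hs). pose proof (pow2_ge_0 s). nra. }
  pose proof (Hstep P t HP ltac:(lra)) as HsP.
  pose proof (Hstep Q (- t) HQ' ltac:(lra)) as HsQ.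
  apply Rle_trans with (exp (INR N * (Q * - t + 2 * (- t) ^ 2)) * exp (INR N * (P * t + 2 * t ^ 2))).
  - apply Rmult_le_compat; tauto.
  - right. rewrite <- exp_plus. f_equal. unfold gap. fold P Q. ring.
Qed.

Section Step.
Context (n : nat) (p q : nat -> R) (Hp : is_distr n p) (Hq : is_distr n q) (L : nat) (HL : (1 <= L)%nat).

(** Half of the mean difference of hits when [2 ^ b * L] samples meet a squared gap of exactly
    [/ 2 ^ (b + 1)]. *)
Definition threshold (b : nat) : R := sqrt (INR L ^ 2 * 2 ^ b / 8).

(* Empty sets, which may not be queried, get a test with no queries; it accepts since [threshold b > 0]. *)
Definition step_test (b : nat) (S T : nat -> bool) : test :=
  (repeat S (if existsb S (dom n) then 2 ^ b * L else 0),
   fun ap aq => if Rlt_dec (Rabs (hits T ap - hits T aq)) (threshold b) then true else false).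

Lemma step_test_valid (b : nat) (S T : nat -> bool) :
  Forall (nonempty_in n) (fst (step_test b S T)).
Proof.
  simpl. destruct (existsb S (dom n)) eqn:HS; [|constructor].
  apply forall_repeat. now apply existsb_nonempty_in.
Qed.

Let L_pos : 0 < INR L.
Proof. apply lt_0_INR. lia. Qed.

Lemma threshold_pos (b : nat) : 0 < threshold b.
Proof.
  apply sqrt_lt_R0. assert (0 < 2 ^ b) by (apply pow_lt; lra).
  assert (0 < INR L ^ 2) by now apply pow_lt. nra.
Qed.

Lemma threshold_sqr (b : nat) : threshold b * threshold b = INR L ^ 2 * 2 ^ b / 8.
Proof.
  apply sqrt_sqrt. assert (0 < 2 ^ b) by (apply pow_lt; lra).
  assert (0 < INR L ^ 2) by now apply pow_lt. nra.
Qed.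

Lemma INR_samples (b : nat) : INR (2 ^ b * L) = 2 ^ b * INR L.
Proof. rewrite mult_INR, pow_INR. reflexivity. Qed.

(** The minimiser in [t] of the Chernoff exponent [4 * N * t ^ 2 - t * threshold b] for
    [N = 2 ^ b * L]; the minimum is [- L / 128] on every scale. *)
Let tilt (b : nat) : R := threshold b / (8 * (2 ^ b * INR L)).

Lemma tilt_spec (b : nat) :
  0 < tilt b <= / 2 /\
  2 ^ b * INR L * (4 * tilt b ^ 2) - tilt b * threshold b = - (INR L / 128).
Proof.
  assert (Hb : 1 <= 2 ^ b) by (apply pow_R1_Rle; lra).
  pose proof (threshold_pos b) as Ha. pose proof (threshold_sqr b) as Hs.
  assert (HN : 0 < 2 ^ b * INR L) by nra.
  assert (Hle : threshold b <= 2 ^ b * INR L).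
  { assert (HL2 : 0 <= INR L ^ 2) by apply pow2_ge_0.
    apply Rsqr_incr_0; [unfold Rsqr|lra|lra]. rewrite Hs.
    replace (2 ^ b * INR L * (2 ^ b * INR L)) with (INR L ^ 2 * 2 ^ b * 2 ^ b) by ring.
    assert (0 <= INR L ^ 2 * 2 ^ b) by nra. nra. }
  unfold tilt. split; [split|].
  - apply Rdiv_lt_0_compat; lra.
  - apply Rmult_le_reg_r with (8 * (2 ^ b * INR L)); [lra|].
    unfold Rdiv. rewrite Rmult_assoc, Rinv_l by lra. lra.
  - transitivity (- (threshold b * threshold b / (16 * (2 ^ b * INR L)))).
    + field. split; lra.
    + rewrite Hs. field. split; lra.
Qed.

Lemma accept_bounds (t : test) : Forall (nonempty_in n) (fst t) -> 0 <= accept n p q t <= 1.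
Proof.
  intros HQ. assert (HE := Epq_expectation n p q _ Hp Hq HQ). unfold accept. split.
  - apply (ex_nonneg HE). intros a. destruct (snd t _ _); lra.
  - eapply Rle_trans; [|right; apply (ex_one _ HE)].
    apply (ex_le _ HE). intros a. destruct (snd t _ _); lra.
Qed.

Lemma step_test_null (b : nat) (S T : nat -> bool) :
  gap n p q S T = 0 -> 1 - 2 * exp (- (INR L / 128)) <= accept n p q (step_test b S T).
Proof.
  intros Hgap. assert (HE := Epq_expectation n p q _ Hp Hq (step_test_valid b S T)).
  destruct (tilt_spec b) as [Ht Hspec]. pose proof (threshold_pos b) as Ha.
  unfold accept. cbn [step_test fst snd] in *.
  destruct (existsb S (dom n)) eqn:HS.
  2:{ unfold Epq. simpl. rewrite Rminus_0_r, Rabs_R0.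
      destruct (Rlt_dec _ _); [|contradiction]. pose proof (exp_pos (- (INR L / 128))). lra. }
  apply existsb_nonempty_in in HS. set (N := (2 ^ b * L)%nat) in *.
  set (X := fun a : list nat * list nat => hits T (fst a) - hits T (snd a)).
  set (e := exp (- (tilt b * threshold b))).
  (* Exponential Markov for both tails at once: on rejection one of the two exponentials is at least
     [/ e]. *)
  apply Rle_trans with (Epq n p q (repeat S N) (fun a => 1 - e * (exp (tilt b * X a) + exp (- tilt b * X a)))).
  - rewrite (ex_minus HE), (ex_const HE), (ex_scal _ HE), (ex_plus _ HE).
    pose proof (hits_diff_mgf n p q S T N (tilt b) Hp Hq HS ltac:(lra)) as H1.
    pose proof (hits_diff_mgf n p q S T N (- tilt b) Hp Hq HS ltac:(lra)) as H2.
    rewrite Hgap in H1, H2. fold (X : list nat * list nat -> R) in H1, H2.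
    assert (He : e * exp (INR N * (tilt b * 0 + 4 * tilt b ^ 2)) = exp (- (INR L / 128))).
    { unfold e. rewrite <- exp_plus, <- Hspec. f_equal. unfold N. rewrite INR_samples. ring. }
    replace (- tilt b * 0 + 4 * (- tilt b) ^ 2) with (tilt b * 0 + 4 * tilt b ^ 2) in H2 by ring.
    assert (He0 : 0 < e) by apply exp_pos. rewrite <- He. unfold X in *. nra.
  - apply (ex_le _ HE). intros a.
    pose proof (exp_pos (tilt b * X a)) as P1. pose proof (exp_pos (- tilt b * X a)) as P2.
    assert (He0 : 0 < e) by apply exp_pos.
    change (hits T (fst a) - hits T (snd a)) with (X a).
    destruct (Rlt_dec (Rabs (X a)) (threshold b)) as [H|H]; [nra|].
    apply Rnot_lt_le in H.
    assert (1 <= e * (exp (tilt b * X a) + exp (- tilt b * X a))); [|lra].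
    rewrite Rmult_plus_distr_l. unfold e in *. rewrite <- !exp_plus.
    destruct (Rle_dec 0 (X a)) as [HX|HX].
    + rewrite Rabs_pos_eq in H by assumption.
      pose proof (exp_ge_1 (- (tilt b * threshold b) + tilt b * X a) ltac:(nra)).
      pose proof (exp_pos (- (tilt b * threshold b) + - tilt b * X a)). lra.
    + rewrite Rabs_left in H by lra.
      pose proof (exp_ge_1 (- (tilt b * threshold b) + - tilt b * X a) ltac:(nra)).
      pose proof (exp_pos (- (tilt b * threshold b) + tilt b * X a)). lra.
Qed.

(** The mean difference is at least twice the threshold in absolute value, so acceptance is a
    deviation by at least the threshold and has the same exponent as in the null case. *)
Lemma step_test_detect (b : nat) (S T : nat -> bool) :
  / 2 ^ Datatypes.S b <= gap n p q S T * gap n p q S T ->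
  accept n p q (step_test b S T) <= exp (- (INR L / 128)).
Proof.
  intros Hgap. assert (HE := Epq_expectation n p q _ Hp Hq (step_test_valid b S T)).
  destruct (tilt_spec b) as [Ht Hspec]. pose proof (threshold_pos b) as Ha.
  assert (Hb : 0 < 2 ^ b) by (apply pow_lt; lra).
  unfold accept. cbn [step_test fst snd] in *.
  destruct (existsb S (dom n)) eqn:HS.
  2:{ exfalso. assert (gap n p q S T = 0) as Hz by (unfold gap; rewrite !hit_empty by assumption; lra).
      rewrite Hz in Hgap. assert (0 < / 2 ^ Datatypes.S b) by (apply Rinv_0_lt_compat, pow_lt; lra). lra. }
  apply existsb_nonempty_in in HS. set (N := (2 ^ b * L)%nat) in *.
  set (X := fun a : list nat * list nat => hits T (fst a) - hits T (snd a)).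
  set (g := gap n p q S T) in *.
  assert (Hbig : 2 * threshold b <= INR N * Rabs g).
  { apply Rsqr_incr_0; [|lra|apply Rmult_le_pos; [apply pos_INR|apply Rabs_pos]].
    unfold Rsqr. replace (INR N * Rabs g * (INR N * Rabs g)) with (INR N * INR N * (Rabs g * Rabs g)) by ring.
    rewrite <- Rabs_mult, (Rabs_pos_eq (g * g)) by apply Rle_0_sqr.
    replace (2 * threshold b * (2 * threshold b)) with (4 * (threshold b * threshold b)) by ring.
    rewrite threshold_sqr. unfold N. rewrite INR_samples.
    apply Rle_trans with (2 ^ b * INR L * (2 ^ b * INR L) * / 2 ^ Datatypes.S b).
    - right. cbn [pow]. field. lra.
    - apply Rmult_le_compat_l; [apply Rle_0_sqr|assumption]. }
  (* [s] has the sign opposite to the drift, so that [s * X] is large on the accepting event *)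
  set (s := if Rle_dec 0 g then - tilt b else tilt b).
  assert (Hsg : s * g = - (tilt b * Rabs g) /\ s ^ 2 = tilt b ^ 2 /\ - / 2 <= s <= / 2 /\
    Rabs s = tilt b).
  { unfold s. destruct (Rle_dec 0 g) as [H|H].
    - rewrite Rabs_pos_eq, Rabs_Ropp, Rabs_pos_eq by lra. repeat split; try ring; lra.
    - rewrite (Rabs_left g), Rabs_pos_eq by lra. repeat split; try ring; lra. }
  destruct Hsg as [Hsg [Hs2 [Hsb Habs]]].
  set (e := exp (tilt b * threshold b)).
  apply Rle_trans with (Epq n p q (repeat S N) (fun a => e * exp (s * X a))).
  - apply (ex_le _ HE). intros a. change (hits T (fst a) - hits T (snd a)) with (X a).
    unfold e. rewrite <- exp_plus.
    destruct (Rlt_dec (Rabs (X a)) (threshold b)) as [H|H]; [|left; apply exp_pos].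
    apply exp_ge_1. pose proof (Rle_abs (- (s * X a))) as Hn.
    rewrite Rabs_Ropp, Rabs_mult, Habs in Hn. pose proof (Rabs_pos (X a)). nra.
  - rewrite (ex_scal _ HE).
    pose proof (hits_diff_mgf n p q S T N s Hp Hq HS Hsb) as H1. fold g in H1.
    assert (He0 : 0 < e) by apply exp_pos.
    apply Rle_trans with (e * exp (INR N * (s * g + 4 * s ^ 2))).
    + apply Rmult_le_compat_l; [lra|exact H1].
    + unfold e. rewrite <- exp_plus. apply exp_le_mono.
      rewrite Hsg, Hs2, <- Hspec. unfold N in *. rewrite INR_samples in *. nra.
Qed.

End Step.
(** * The tester *)

Lemma lprod_bounds {X : Type} (l : list X) (f : X -> R) :
  (forall x, In x l -> 0 <= f x <= 1) -> 0 <= lprod l f <= 1.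
Proof.
  induction l as [|x l IH]; intros H; simpl; [lra|].
  assert (0 <= f x <= 1) by (apply H; now left).
  assert (0 <= lprod l f <= 1) by (apply IH; intros; apply H; now right). nra.
Qed.

(** The union bound, in the form of Weierstrass's product inequality. *)
Lemma lprod_ge {X : Type} (l : list X) (f : X -> R) :
  (forall x, In x l -> 0 <= f x <= 1) -> 1 - lsum l (fun x => 1 - f x) <= lprod l f.
Proof.
  induction l as [|x l IH]; intros H; simpl; [lra|].
  assert (0 <= f x <= 1) by (apply H; now left).
  assert (Hl : forall y, In y l -> 0 <= f y <= 1) by (intros; apply H; now right).
  specialize (IH Hl). pose proof (lprod_bounds l f Hl).
  change (fold_right _ 1 l) with (lprod l f).
  change (fold_right _ 0 l) with (lsum l (fun x => 1 - f x)).
  assert (0 <= (1 - f x) * (1 - lprod l f)) by (apply Rmult_le_pos; lra). nra.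
Qed.

Lemma lprod_exp_le {X : Type} (l : list X) (f g : X -> R) :
  (forall x, In x l -> 0 <= f x <= 1 - g x) -> lprod l f <= exp (- lsum l g).
Proof.
  induction l as [|x l IH]; intros H; simpl; [rewrite Ropp_0, exp_0; lra|].
  rewrite Ropp_plus_distr, exp_plus.
  assert (0 <= f x <= 1 - g x) by (apply H; now left).
  assert (Hl : forall y, In y l -> 0 <= f y <= 1 - g y) by (intros; apply H; now right).
  apply Rmult_le_compat; [lra| |pose proof (exp_ineq1_le (- g x)); lra|now apply IH].
  clear - Hl. induction l as [|y l IH]; simpl; [lra|].
  apply Rmult_le_pos; [apply (Hl y); now left|apply IH; intros; apply Hl; now right].
Qed.

Lemma lprod_app {X : Type} (l l' : list X) (f : X -> R) :
  lprod (l ++ l') f = lprod l f * lprod l' f.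
Proof. induction l as [|x l IH]; simpl; [ring|rewrite IH; ring]. Qed.

Lemma lprod_flat_map {X Y : Type} (h : X -> list Y) (l : list X) (f : Y -> R) :
  lprod (flat_map h l) f = lprod l (fun x => lprod (h x) f).
Proof. induction l as [|x l IH]; simpl; [reflexivity|now rewrite lprod_app, IH]. Qed.

Lemma lsum_repeat {X : Type} (x : X) (N : nat) (f : X -> R) :
  lsum (repeat x N) f = INR N * f x.
Proof.
  induction N as [|N IH]; [simpl; ring|]. rewrite S_INR. simpl. rewrite IH. ring.
Qed.

Lemma avg_le_in {X : Type} (l : list X) (f g : X -> R) :
  (forall x, In x l -> f x <= g x) -> avg l f <= avg l g.
Proof.
  intros H. unfold avg, Rdiv. apply Rmult_le_compat_r; [|now apply lsum_le].
  destruct l; [simpl; rewrite Rinv_0; lra|].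
  left. apply Rinv_0_lt_compat, lt_0_INR. simpl. lia.
Qed.

Fixpoint path_sum (g : (nat -> bool) -> (nat -> bool) -> R) (S : nat -> bool)
    (Bs : list (list bool)) : R :=
  match Bs with
  | [] => 0
  | B :: Bs' => g S (inter S B) + path_sum g (inter S B) Bs'
  end.

Definition masks (n : nat) : list (list bool) := tuples n [true; false].

Lemma masks_nonempty (n : nat) : masks n <> [].
Proof. apply tuples_nonempty. discriminate. Qed.

Lemma avg_path_sum (n : nat) (g : (nat -> bool) -> (nat -> bool) -> R) (k l : nat)
    (S : nat -> bool) :
  avg (tuples k (masks n)) (path_sum g S) =
  chain_sum n (fun _ S => Ehalf n (fun B => g S (inter S B))) k l S.
Proof.
  assert (HE := Ehalf_expectation n).
  revert l S; induction k as [|k IH]; intros l S; [apply avg_tuples_0|].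
  rewrite avg_tuples_S by apply masks_nonempty. cbn [path_sum chain_sum].
  assert (Hk := avg_expectation _ (tuples_nonempty k _ (masks_nonempty n))).
  rewrite <- (ex_plus _ HE). apply (ex_ext HE). intros B.
  rewrite (ex_plus _ Hk), (ex_const Hk). f_equal. apply IH.
Qed.

(** By induction on [B]: either [x] is below the new remainder [/ 2 ^ S B], or the new layer is
    switched on and its weight [/ 2 ^ B] replaces the old remainder. *)
Lemma dyadic_layers (x : R) (B : nat) :
  0 <= x <= 1 ->
  x <= / 2 ^ B + lsum (seq 0 B) (fun b => / 2 ^ b * (if Rle_dec (/ 2 ^ S b) x then 1 else 0)).
Proof.
  intros Hx. induction B as [|B IH]; [simpl; lra|].
  rewrite seq_S, lsum_app. simpl (0 + B)%nat. unfold lsum at 2. cbn [fold_right].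
  set (T := lsum _ _) in *.
  assert (HT : 0 <= T).
  { apply lsum_nonneg. intros b _. assert (0 < / 2 ^ b) by (apply Rinv_0_lt_compat, pow_lt; lra).
    destruct (Rle_dec _ _); lra. }
  assert (0 < / 2 ^ S B) by (apply Rinv_0_lt_compat, pow_lt; lra).
  destruct (Rle_dec (/ 2 ^ S B) x); lra.
Qed.

Fixpoint chain_tests (n L b : nat) (S : nat -> bool) (Bs : list (list bool)) : list test :=
  match Bs with
  | [] => []
  | B :: Bs' => step_test n L b S (inter S B) :: chain_tests n L b (inter S B) Bs'
  end.

(* Scale [b] looks for gaps of order [2 ^ (- b / 2)], with about [2 ^ b] queries per set; the
   number of its chains is chosen so that all scales cost the same. *)
Definition scales (B : nat) : list nat :=
  flat_map (fun b => repeat b (2 ^ (B - b) * 4)) (seq 0 B).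

Definition seed : Type := list (list (list bool)).

Definition seeds (n k B : nat) : list seed :=
  tuples (length (scales B)) (tuples k (masks n)).

Definition seed_tests (n L B : nat) (s : seed) : list test :=
  flat_map (fun bc => chain_tests n L (fst bc) (fun _ => true) (snd bc)) (combine (scales B) s).

(** Scale [b] is repeated [4 * 2 ^ (B - b)] times. The weight [/ 2 ^ b] cancels the [2 ^ b] samples
    per set in the query count and matches the weights of [dyadic_layers]. *)
Lemma scales_weight (B : nat) (f : nat -> R) :
  lsum (scales B) f = 4 * 2 ^ B * lsum (seq 0 B) (fun b => / 2 ^ b * f b).
Proof.
  unfold scales. rewrite lsum_flat_map, <- lsum_scal. apply lsum_ext. intros b Hb.
  apply in_seq in Hb. rewrite lsum_repeat, mult_INR, pow_INR.
  assert (Hp : 0 < 2 ^ b) by (apply pow_lt; lra).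
  replace (2 ^ B) with (2 ^ (B - b) * 2 ^ b) by (rewrite <- pow_add; f_equal; lia).
  change (INR 2) with 2. replace (INR 4) with 4 by (simpl; lra). field. lra.
Qed.

Lemma gap_sqr_bounds (n : nat) (p q : nat -> R) (S T : nat -> bool) :
  is_distr n p -> is_distr n q -> 0 <= gap n p q S T * gap n p q S T <= 1.
Proof.
  intros Hp Hq. split; [apply Rle_0_sqr|].
  assert (Hg : -1 <= gap n p q S T <= 1); [|nra].
  unfold gap. destruct (existsb S (dom n)) eqn:HS.
  - apply existsb_nonempty_in in HS.
    pose proof (hit_bounds n p S T Hp HS). pose proof (hit_bounds n q S T Hq HS). lra.
  - assert (Hc : forall r, hit n r S T = 0); [|rewrite !Hc; lra].
    intros r. now apply hit_empty.
Qed.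

(** * Size and error probabilities of the tester *)

Section Tester.
Context (n : nat) (p q : nat -> R) (Hp : is_distr n p) (Hq : is_distr n q) (L : nat).

Lemma chain_tests_valid (b : nat) (S : nat -> bool) (Bs : list (list bool)) (t : test) :
  In t (chain_tests n L b S Bs) -> Forall (nonempty_in n) (fst t).
Proof.
  revert S; induction Bs as [|B Bs IH]; intros S; [intros []|].
  intros [<-|Ht]; [apply step_test_valid|now apply (IH (inter S B))].
Qed.

Lemma chain_tests_queries (b : nat) (S : nat -> bool) (Bs : list (list bool)) :
  (length (queries (chain_tests n L b S Bs)) <= length Bs * (2 ^ b * L))%nat.
Proof.
  revert S; induction Bs as [|B Bs IH]; intros S; [simpl; lia|].
  cbn [chain_tests queries flat_map step_test fst]. rewrite length_app, repeat_length.
  specialize (IH (inter S B)). fold (queries (chain_tests n L b (inter S B) Bs)).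
  cbn [length]. destruct (existsb _ _); nia.
Qed.

Lemma seeds_nonempty (k B : nat) : seeds n k B <> [].
Proof. apply tuples_nonempty, tuples_nonempty, masks_nonempty. Qed.

Lemma seed_tests_valid (B : nat) (s : seed) :
  Forall (nonempty_in n) (queries (seed_tests n L B s)).
Proof.
  apply Forall_flat_map, Forall_forall. intros t Ht.
  apply in_flat_map in Ht as [bc [_ Ht]]. now apply chain_tests_valid in Ht.
Qed.

(** The masks of all chains are the whole internal randomness, drawn uniformly as an index into
    [seeds]. Every query set is a function of the masks, and both oracles get the same sets. *)
Definition tester (k B : nat) : nacond_alg := {|
  na_seeds := length (seeds n k B);
  na_weight := fun _ => / INR (length (seeds n k B));
  na_qp := fun r => queries (seed_tests n L B (nth r (seeds n k B) []));
  na_qq := fun r => queries (seed_tests n L B (nth r (seeds n k B) []));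
  na_out := fun r => verdict (seed_tests n L B (nth r (seeds n k B) [])) |}.

Lemma tester_well_formed (k B : nat) : well_formed n (tester k B).
Proof.
  assert (Hpos : 0 < INR (length (seeds n k B))).
  { pose proof (seeds_nonempty k B). destruct (seeds n k B); [contradiction|].
    apply lt_0_INR. simpl. lia. }
  repeat split; simpl.
  - intros. left. now apply Rinv_0_lt_compat.
  - rewrite sumR_lsum, lsum_const, length_seq. apply Rinv_r. lra.
  - apply seed_tests_valid.
  - apply seed_tests_valid.
Qed.

Lemma tester_queries (k B r : nat) :
  (r < na_seeds (tester k B))%nat ->
  INR (length (na_qp (tester k B) r)) <= 4 * 2 ^ B * INR B * INR k * INR L.
Proof.
  cbn [tester na_seeds na_qp]. intros Hr. apply (nth_In _ []) in Hr.
  set (s := nth r _ _) in *.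
  apply Rle_trans with (lsum (scales B) (fun b => INR k * (2 ^ b * INR L))).
  - unfold seed_tests, seeds in *. clearbody s. revert s Hr.
    induction (scales B) as [|b bs IH]; intros s Hs; [simpl; lra|].
    cbn [length tuples] in Hs. apply in_flat_map in Hs as [Bs [HBs Hs]].
    apply in_map_iff in Hs as [s' [<- Hs]]. specialize (IH s' Hs).
    cbn [combine flat_map fst snd]. unfold queries in *. rewrite flat_map_app, length_app, plus_INR.
    cbn [lsum fold_right]. apply Rplus_le_compat; [|exact IH].
    apply in_tuples_length in HBs. rewrite <- HBs.
    eapply Rle_trans; [apply le_INR, chain_tests_queries|].
    right. now rewrite mult_INR, INR_samples.
  - rewrite scales_weight. right.
    rewrite (lsum_ext _ _ (fun _ => INR k * INR L)).
    + rewrite lsum_const, length_seq. ring.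
    + intros b _. assert (0 < 2 ^ b) by (apply pow_lt; lra). field. lra.
Qed.

Lemma chain_tests_bounds (b : nat) (S : nat -> bool) (Bs : list (list bool)) :
  0 <= lprod (chain_tests n L b S Bs) (accept n p q) <= 1.
Proof.
  apply lprod_bounds. intros t Ht. apply accept_bounds; [assumption..|].
  now apply chain_tests_valid in Ht.
Qed.

Lemma avg_seed_tests (k B : nat) :
  avg (seeds n k B) (fun s => lprod (seed_tests n L B s) (accept n p q)) =
  lprod (scales B) (fun b => avg (tuples k (masks n))
    (fun Bs => lprod (chain_tests n L b (fun _ => true) Bs) (accept n p q))).
Proof.
  rewrite <- (avg_tuples_combine (scales B) (tuples k (masks n))
    (fun b Bs => lprod (chain_tests n L b (fun _ => true) Bs) (accept n p q)))
    by apply tuples_nonempty, masks_nonempty.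
  unfold avg. f_equal. apply lsum_ext. intros s _. apply lprod_flat_map.
Qed.

Lemma out_prob_tester_true (k B : nat) :
  out_prob n (tester k B) p q true =
  avg (seeds n k B) (fun s => lprod (seed_tests n L B s) (accept n p q)).
Proof.
  unfold out_prob. cbn [tester na_seeds na_weight na_qp na_qq na_out].
  rewrite sumR_lsum, lsum_scal. unfold avg, Rdiv. rewrite Rmult_comm. f_equal.
  rewrite <- (lsum_seq_nth (seeds n k B) []). apply lsum_ext. intros r _.
  rewrite <- accept_verdict; [|assumption..|apply seed_tests_valid].
  unfold Epq. apply exp_answers_ext. intros ap _. apply exp_answers_ext. intros aq _.
  cbn [fst snd]. now destruct (verdict _ ap aq).
Qed.

Lemma out_prob_tester_false (k B : nat) :
  out_prob n (tester k B) p q false = 1 - out_prob n (tester k B) p q true.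
Proof.
  enough (out_prob n (tester k B) p q true + out_prob n (tester k B) p q false = 1) by lra.
  unfold out_prob. rewrite sumR_lsum, <- lsum_plus.
  destruct (tester_well_formed k B) as [_ [Hw HQ]].
  transitivity (lsum (seq 0 (na_seeds (tester k B))) (na_weight (tester k B))); [|exact Hw].
  apply lsum_ext. intros r Hr. apply in_seq in Hr.
  destruct (HQ r ltac:(lia)) as [HQp HQq].
  assert (HEp := exp_answers_expectation n p _ Hp HQp).
  assert (HEq := exp_answers_expectation n q _ Hq HQq).
  rewrite <- Rmult_plus_distr_l, <- (ex_plus _ HEp).
  rewrite (ex_ext HEp _ (fun _ => 1)); [rewrite (ex_one _ HEp); ring|].
  intros ap. rewrite <- (ex_plus _ HEq), (ex_ext HEq _ (fun _ => 1)); [apply (ex_one _ HEq)|].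
  intros aq. destruct (na_out _ r ap aq); simpl; lra.
Qed.

Context (HL : (1 <= L)%nat).

Let err : R := exp (- (INR L / 128)).

Definition large_gap (b : nat) (S T : nat -> bool) : R :=
  if Rle_dec (/ 2 ^ Datatypes.S b) (gap n p q S T * gap n p q S T) then 1 else 0.

Lemma chain_tests_null (b : nat) (S : nat -> bool) (Bs : list (list bool)) :
  (forall S T, gap n p q S T = 0) ->
  1 - INR (length Bs) * (2 * err) <= lprod (chain_tests n L b S Bs) (accept n p q).
Proof.
  intros H0. revert S; induction Bs as [|B Bs IH]; intros S; [simpl; lra|].
  cbn [length]. rewrite S_INR. simpl lprod. specialize (IH (inter S B)).
  pose proof (chain_tests_bounds b (inter S B) Bs) as Hb.
  pose proof (step_test_null n p q Hp Hq L HL b S (inter S B) (H0 _ _)) as Ha.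
  pose proof (accept_bounds n p q Hp Hq _ (step_test_valid n L b S (inter S B))) as Hab.
  fold err in Ha. set (x := accept _ _ _ _) in *. set (y := lprod _ _) in *.
  assert (0 <= (1 - x) * (1 - y)) by (apply Rmult_le_pos; lra). nra.
Qed.

(** One step with a large gap makes its own test reject with probability at least 1/2. The number of
    such steps is recorded because its mean, unlike the probability that there is one, is tied to
    the energy. *)
Lemma chain_tests_detect (b : nat) (S : nat -> bool) (Bs : list (list bool)) :
  err <= / 2 ->
  0 <= path_sum (large_gap b) S Bs <= INR (length Bs) /\
  (0 < path_sum (large_gap b) S Bs -> lprod (chain_tests n L b S Bs) (accept n p q) <= / 2).
Proof.
  intros Herr. revert S; induction Bs as [|B Bs IH]; intros S; [simpl; split; [lra|lra]|].
  cbn [length path_sum]. rewrite S_INR. simpl lprod. destruct (IH (inter S B)) as [IH1 IH2].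
  pose proof (chain_tests_bounds b (inter S B) Bs) as Hb.
  pose proof (accept_bounds n p q Hp Hq _ (step_test_valid n L b S (inter S B))) as Hab.
  assert (Hg : 0 <= large_gap b S (inter S B) <= 1 /\
    (0 < large_gap b S (inter S B) -> accept n p q (step_test n L b S (inter S B)) <= / 2)).
  { unfold large_gap. destruct (Rle_dec _ _) as [H|H]; split; try lra.
    intros _. pose proof (step_test_detect n p q Hp Hq L HL b S (inter S B) H) as Hdet.
    fold err in Hdet. lra. }
  destruct Hg as [Hg1 Hg2]. split; [lra|]. intros Hpos.
  set (x := accept _ _ _ _) in *. set (y := lprod _ _) in *.
  destruct (Rlt_dec 0 (large_gap b S (inter S B))) as [H|H]; [specialize (Hg2 H); nra|].
  assert (y <= / 2) by (apply IH2; lra). nra.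
Qed.

(** A union bound over fewer than [8 * 2 ^ B] chains of [k] tests, each with error at most
    [2 * err]. *)
Lemma seed_tests_null (k B : nat) :
  (forall S T, gap n p q S T = 0) ->
  1 - 16 * 2 ^ B * INR k * err <=
  avg (seeds n k B) (fun s => lprod (seed_tests n L B s) (accept n p q)).
Proof.
  intros H0. rewrite avg_seed_tests.
  set (A := fun b => avg (tuples k (masks n)) _).
  assert (Hk := avg_expectation _ (tuples_nonempty k _ (masks_nonempty n))).
  assert (Herr : 0 < err) by apply exp_pos.
  assert (HA : forall b, 1 - INR k * (2 * err) <= A b).
  { intros b. rewrite <- (ex_const Hk (1 - INR k * (2 * err))). apply avg_le_in. intros Bs HBs.
    apply in_tuples_length in HBs. rewrite <- HBs. now apply chain_tests_null. }
  assert (HA1 : forall b, 0 <= A b <= 1).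
  { intros b. split; [apply (ex_nonneg Hk); intros; apply chain_tests_bounds|].
    rewrite <- (ex_one _ Hk). apply (ex_le _ Hk). intros. apply chain_tests_bounds. }
  eapply Rle_trans; [|apply lprod_ge; intros b _; apply HA1].
  assert (Hsum : lsum (scales B) (fun b => 1 - A b) <= lsum (scales B) (fun _ => INR k * (2 * err))).
  { apply lsum_le. intros b _. specialize (HA b). lra. }
  rewrite (scales_weight B (fun _ => INR k * (2 * err))) in Hsum.
  assert (Hgeo : lsum (seq 0 B) (fun b => / 2 ^ b * (INR k * (2 * err))) =
    (2 - 2 * / 2 ^ B) * (INR k * (2 * err))).
  { clear. induction B as [|B IH]; [simpl; lra|].
    rewrite seq_S, lsum_app, IH. cbn [lsum fold_right Nat.add pow].
    assert (0 < 2 ^ B) by (apply pow_lt; lra). field. lra. }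
  rewrite Hgeo in Hsum.
  assert (Hp2 : 0 < 2 ^ B) by (apply pow_lt; lra).
  assert (Hkerr : 0 <= INR k * err) by (apply Rmult_le_pos; [apply pos_INR|lra]).
  replace (4 * 2 ^ B * ((2 - 2 * / 2 ^ B) * (INR k * (2 * err))))
    with (16 * 2 ^ B * INR k * err - 16 * (INR k * err)) in Hsum by (field; lra).
  lra.
Qed.

(** Split the energy into dyadic layers. A chain of scale [b] rejects with probability at least
    [u b / (2 * k)], where [u b] is the mean number of large gaps on it. Independence of the chains
    puts the sum of these numbers into the exponent, and [scales] weights it like the layers. *)
Lemma seed_tests_far (k B : nat) (theta : R) :
  (1 <= k)%nat -> err <= / 2 -> 0 < theta -> 2 * INR k / theta <= 2 ^ B ->
  theta <= chain_sum n (fun _ S => Ehalf n (fun B =>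
    gap n p q S (inter S B) * gap n p q S (inter S B))) k 0 (fun _ => true) ->
  avg (seeds n k B) (fun s => lprod (seed_tests n L B s) (accept n p q)) <= exp (-2).
Proof.
  intros Hk1 Herr Htheta HB Henergy. rewrite avg_seed_tests.
  assert (Hk0 : 1 <= INR k) by now apply (le_INR 1).
  assert (Hp2 : 0 < 2 ^ B) by (apply pow_lt; lra).
  assert (HE := avg_expectation _ (tuples_nonempty k _ (masks_nonempty n))).
  set (full := fun _ : nat => true) in *.
  set (u := fun b => avg (tuples k (masks n)) (path_sum (large_gap b) full)).
  assert (Hlayer : theta <= INR k * / 2 ^ B + lsum (seq 0 B) (fun b => / 2 ^ b * u b)).
  { rewrite <- (avg_path_sum n (fun S T => gap n p q S T * gap n p q S T)) in Henergy.
    eapply Rle_trans; [exact Henergy|].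
    rewrite (lsum_ext _ (fun b => / 2 ^ b * u b)
      (fun b => avg (tuples k (masks n)) (fun Bs => / 2 ^ b * path_sum (large_gap b) full Bs)))
      by (intros; now rewrite (ex_scal _ HE)).
    rewrite <- (ex_lsum HE), <- (ex_const HE (INR k * / 2 ^ B)), <- (ex_plus _ HE).
    apply avg_le_in. intros Bs HBs. apply in_tuples_length in HBs. rewrite <- HBs.
    generalize full. clear - Hp Hq. induction Bs as [|B' Bs IH]; intros S.
    - simpl. rewrite (lsum_ext _ _ (fun _ => 0)), lsum_const by (intros; ring). lra.
    - cbn [path_sum length]. rewrite S_INR. specialize (IH (inter S B')).
      pose proof (dyadic_layers _ B (gap_sqr_bounds n p q S (inter S B') Hp Hq)) as Hd.
      rewrite (lsum_ext _ (fun b => / 2 ^ b * (large_gap b S (inter S B') + _))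
        (fun b => / 2 ^ b * large_gap b S (inter S B') +
                  / 2 ^ b * path_sum (large_gap b) (inter S B') Bs)) by (intros; ring).
      rewrite lsum_plus. unfold large_gap at 1. lra. }
  eapply Rle_trans.
  { apply (lprod_exp_le _ _ (fun b => u b * / (2 * INR k))). intros b _. split.
    - apply (ex_nonneg HE). intros; apply chain_tests_bounds.
    - apply Rle_trans with (avg (tuples k (masks n))
        (fun Bs => 1 - / (2 * INR k) * path_sum (large_gap b) full Bs)).
      2:{ rewrite (ex_minus HE), (ex_const HE), (ex_scal _ HE). unfold u.
          right. f_equal. apply Rmult_comm. }
      apply avg_le_in. intros Bs HBs. apply in_tuples_length in HBs.
      destruct (chain_tests_detect b full Bs Herr) as [Hd1 Hd2].
      pose proof (chain_tests_bounds b full Bs) as Hb. rewrite HBs in Hd1.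
      set (y := path_sum _ _ _) in *.
      (* At most [k] steps are counted, so the count divided by [2 * k] is at most 1/2, the
         rejection probability once the count is positive. *)
      assert (Hfrac : 0 <= / (2 * INR k) * y <= / 2).
      { split; [apply Rmult_le_pos; [left; apply Rinv_0_lt_compat; lra|lra]|].
        apply Rmult_le_reg_l with (2 * INR k); [lra|].
        rewrite <- Rmult_assoc, Rinv_r by lra. lra. }
      destruct (Rlt_dec 0 y) as [Hy|Hy]; [specialize (Hd2 Hy); lra|].
      assert (y = 0) as -> by lra. rewrite Rmult_0_r in *. lra. }
  apply exp_le_mono.
  enough (2 <= lsum (scales B) (fun b => u b * / (2 * INR k))) by lra.
  rewrite scales_weight.
  rewrite (lsum_ext _ _ (fun b => / (2 * INR k) * (/ 2 ^ b * u b))) by (intros; ring).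
  rewrite lsum_scal. set (U := lsum _ _) in *.
  (* The part of the energy below the finest scale is at most half of [theta]. *)
  assert (HkB : INR k * / 2 ^ B <= theta / 2).
  { apply Rmult_le_reg_r with (2 ^ B * (2 / theta)).
    - apply Rmult_lt_0_compat; [assumption|]. apply Rdiv_lt_0_compat; lra.
    - replace (INR k * / 2 ^ B * (2 ^ B * (2 / theta))) with (2 * INR k / theta) by (field; lra).
      replace (theta / 2 * (2 ^ B * (2 / theta))) with (2 ^ B) by (field; lra). assumption. }
  apply Rle_trans with (4 * 2 ^ B * (/ (2 * INR k) * (theta / 2))).
  - apply Rle_trans with (2 * INR k / theta * (theta / INR k)).
    + right. field. lra.
    + replace (4 * 2 ^ B * (/ (2 * INR k) * (theta / 2))) with (2 ^ B * (theta / INR k)) by (field; lra).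
      apply Rmult_le_compat_r; [|assumption]. left. apply Rdiv_lt_0_compat; lra.
  - apply Rmult_le_compat_l; [lra|]. apply Rmult_le_compat_l; [|lra].
    left. apply Rinv_0_lt_compat. lra.
Qed.

End Tester.

(** * Base-2 logarithms *)

Lemma pow2_exp (B : nat) : 2 ^ B = exp (INR B * ln 2).
Proof. rewrite <- Rpower_pow by lra. reflexivity. Qed.

Lemma ln2_pos : 0 < ln 2.
Proof. rewrite <- ln_1. apply ln_increasing; lra. Qed.

Lemma log2_le (x y : R) : 0 < x <= y -> log2 x <= log2 y.
Proof.
  intros [Hx Hxy]. unfold log2, Rdiv. apply Rmult_le_compat_r.
  - left. apply Rinv_0_lt_compat, ln2_pos.
  - destruct Hxy as [Hxy| ->]; [left; now apply ln_increasing|lra].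
Qed.

Lemma log2_mult (x y : R) : 0 < x -> 0 < y -> log2 (x * y) = log2 x + log2 y.
Proof.
  intros Hx Hy. unfold log2. rewrite ln_mult by assumption. field.
  pose proof ln2_pos. lra.
Qed.

Lemma log2_pow (x : R) (k : nat) : 0 < x -> log2 (x ^ k) = INR k * log2 x.
Proof. intros Hx. unfold log2. rewrite ln_pow by assumption. unfold Rdiv. ring. Qed.

Lemma log2_2 : log2 2 = 1.
Proof. unfold log2. apply Rinv_r. pose proof ln2_pos. lra. Qed.

Lemma log2_1 : log2 1 = 0.
Proof. unfold log2. rewrite ln_1. unfold Rdiv. ring. Qed.

(** [up] lies strictly above its argument, so exact powers of two are overshot by one; hence the
    bound [2 * x] in the specification. *)
Definition log2_ceil (x : R) : nat := Z.to_nat (up (log2 x)).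

Lemma log2_ceil_spec (x : R) :
  1 <= x -> x <= 2 ^ log2_ceil x <= 2 * x /\ INR (log2_ceil x) <= log2 x + 1.
Proof.
  intros Hx. unfold log2_ceil. destruct (archimed (log2 x)) as [Hup1 Hup2].
  pose proof (log2_le 1 x ltac:(lra)) as H0. rewrite log2_1 in H0.
  assert (Hup0 : (0 <= up (log2 x))%Z) by (apply le_IZR; lra).
  assert (HI : INR (Z.to_nat (up (log2 x))) = IZR (up (log2 x)))
    by (rewrite INR_IZR_INZ, Z2Nat.id by assumption; reflexivity).
  rewrite pow2_exp, HI. pose proof ln2_pos as Hl.
  assert (Hln : log2 x * ln 2 = ln x) by (unfold log2; field; lra).
  split; [split|lra].
  - rewrite <- (exp_ln x) at 1 by lra. apply exp_le_mono. nra.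
  - rewrite <- (exp_ln (2 * x)) by lra. apply exp_le_mono. rewrite ln_mult by lra. nra.
Qed.

(** * Parameters and the query count *)

Definition levels (n : nat) : nat := S (Nat.log2_up n).

Lemma levels_ge (n : nat) : (1 < n)%nat -> INR n <= 2 ^ Nat.log2_up n.
Proof.
  intros Hn. destruct (Nat.log2_up_spec n Hn) as [_ H]. apply le_INR in H.
  rewrite pow_INR in H. exact H.
Qed.

Lemma levels_le (n : nat) : (1 < n)%nat -> INR (levels n) <= log2 (INR n) + 2.
Proof.
  intros Hn. destruct (Nat.log2_up_spec n Hn) as [H _].
  unfold levels. pose proof (Nat.log2_up_pos n Hn).
  destruct (Nat.log2_up n) as [|J]; [lia|]. cbn [Nat.pred] in H.
  apply lt_INR in H. rewrite pow_INR in H. change (INR 2) with 2 in H.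
  pose proof (log2_le (2 ^ J) (INR n) ltac:(split; [apply pow_lt; lra|lra])) as Hl.
  rewrite log2_pow, log2_2 in Hl by lra. rewrite !S_INR. lra.
Qed.

Definition energy (n : nat) (eps : R) : R := eps ^ 2 / (512 * INR (levels n) ^ 3).

Definition scale_count (n : nat) (eps : R) : nat :=
  log2_ceil (2 * INR (levels n) / energy n eps).

Definition sample_factor (B : nat) : nat := (128 * (2 * B + 6))%nat.

(** The exponent is [2 * B + 6]: one [2 ^ B] pays for the chains, one for the steps of a chain, and
    64 is left as a margin. *)
Lemma sample_factor_err (B : nat) :
  exp (- (INR (sample_factor B) / 128)) <= / (64 * 2 ^ B * 2 ^ B).
Proof.
  unfold sample_factor.
  rewrite mult_INR. replace (INR 128) with 128 by (simpl; lra).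
  replace (128 * INR (2 * B + 6) / 128) with (INR (2 * B + 6) * 1) by field.
  rewrite exp_Ropp. apply Rinv_le_contravar.
  - assert (0 < 2 ^ B) by (apply pow_lt; lra). nra.
  - replace (64 * 2 ^ B * 2 ^ B) with ((1 + 1) ^ (2 * B + 6)).
    + apply pow_1_plus_le_exp. lra.
    + replace (1 + 1) with 2 by lra. replace (2 * B + 6)%nat with (B + B + 6)%nat by lia.
      rewrite !pow_add. simpl. ring.
Qed.

(** [2 ^ B] is at most [2048 * N ^ 4 / eps ^ 2], the length of a chain gives one more [N], and [B]
    and [sample_factor B] are both linear in the iterated-logarithm factor [Y]. *)
Lemma query_count_bound (n : nat) (eps : R) :
  (1 < n)%nat -> 0 < eps <= 1 ->
  let B := scale_count n eps in
  4 * 2 ^ B * INR B * INR (levels n) * INR (sample_factor B) <=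
  query_bound (4 * 2048 * 15 * 768 * 16 * 243) 2 n eps.
Proof.
  intros Hn Heps B.
  set (l := log2 (INR n)). set (N := INR (levels n)).
  assert (Hn2 : 2 <= INR n) by (apply (le_INR 2); lia).
  assert (Hl : 1 <= l) by (rewrite <- log2_2; apply log2_le; lra).
  assert (HN : 1 <= N <= l + 2).
  { split; [apply (le_INR 1); unfold levels; lia|now apply levels_le]. }
  assert (He2 : 0 < eps ^ 2 <= 1) by nra.
  assert (HN3 : 1 <= N ^ 3) by (apply pow_R1_Rle; lra).
  assert (Hx : 2 * N / energy n eps = 1024 * N ^ 4 * (/ eps) ^ 2).
  { unfold energy. fold N. field. lra. }
  assert (Hei : 1 <= / eps) by (rewrite <- Rinv_1; apply Rinv_le_contravar; lra).
  assert (HN4 : 1 <= N ^ 4) by (apply pow_R1_Rle; lra).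
  assert (Hei2 : 1 <= (/ eps) ^ 2) by (apply pow_R1_Rle; lra).
  destruct (log2_ceil_spec (2 * N / energy n eps)) as [[_ HB1] HB2]; [rewrite Hx; nra|].
  change (log2_ceil (2 * N / energy n eps)) with B in HB1, HB2.
  rewrite Hx in HB1, HB2.
  rewrite !log2_mult, !log2_pow in HB2 by (try apply pow_lt; nra).
  assert (H1024 : log2 1024 = 10).
  { replace 1024 with (2 ^ 10) by (simpl; lra). rewrite log2_pow, log2_2 by lra. simpl. lra. }
  set (Y := 1 + log2 (1 + l) + log2 (/ eps)).
  assert (Hle : 0 <= log2 (/ eps)) by (rewrite <- log2_1; apply log2_le; lra).
  assert (Hll : 0 <= log2 (1 + l)) by (rewrite <- log2_1; apply log2_le; lra).
  assert (HlN : log2 N <= 1 + log2 (1 + l)).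
  { rewrite <- log2_2 at 1. rewrite <- log2_mult by lra. apply log2_le. lra. }
  rewrite H1024 in HB2. replace (INR 4) with 4 in HB2 by (simpl; lra).
  change (INR 2) with 2 in HB2.
  assert (HBY : INR B <= 15 * Y) by (unfold Y; lra).
  assert (HY : 1 <= Y) by (unfold Y; lra).
  pose proof (pos_INR B) as HB0.
  assert (HL : INR (sample_factor B) <= 768 * (16 * Y)).
  { unfold sample_factor. rewrite mult_INR, plus_INR, mult_INR. simpl (INR 128). simpl (INR 2).
    simpl (INR 6). lra. }
  (* [N <= l + 2 <= 3 * l] because [1 <= l], and [3 ^ 5 = 243]. *)
  assert (HN5 : N ^ 4 * N <= 243 * l ^ 12).
  { apply Rle_trans with ((3 * l) ^ 5).
    - replace (N ^ 4 * N) with (N ^ 5) by ring. apply pow_incr. lra.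
    - replace ((3 * l) ^ 5) with (243 * l ^ 5) by ring. apply Rmult_le_compat_l; [lra|].
      apply Rle_pow; [assumption|lia]. }
  unfold query_bound. fold l Y.
  replace (4 * 2048 * 15 * 768 * 16 * 243 * l ^ 12 / eps ^ 2 * Y ^ 2) with
    (4 * (2048 * (/ eps) ^ 2) * (15 * Y) * (243 * l ^ 12) * (768 * (16 * Y))) by (field; lra).
  assert (Hp : 0 <= 2 ^ B) by (apply pow_le; lra).
  pose proof (pos_INR (sample_factor B)).
  assert (Hl12 : 0 <= l ^ 12) by (apply pow_le; lra).
  apply Rle_trans with (4 * (2048 * N ^ 4 * (/ eps) ^ 2) * (15 * Y) * N * (768 * (16 * Y))).
  - repeat apply Rmult_le_compat; try lra; repeat apply Rmult_le_pos; lra.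
  - replace (4 * (2048 * N ^ 4 * (/ eps) ^ 2) * (15 * Y) * N * (768 * (16 * Y))) with
      (4 * (2048 * (/ eps) ^ 2) * (15 * Y) * (N ^ 4 * N) * (768 * (16 * Y))) by ring.
    apply Rmult_le_compat_r; [lra|]. apply Rmult_le_compat_l; [|exact HN5].
    repeat apply Rmult_le_pos; lra.
Qed.

(** For [n = 1] the query bound is 0, because [log2 1 = 0]; there is only one distribution, so
    accepting is correct. *)
Definition no_query_alg : nacond_alg := {|
  na_seeds := 1;
  na_weight := fun _ => 1;
  na_qp := fun _ => [];
  na_qq := fun _ => [];
  na_out := fun _ _ _ => true |}.

Definition equivalence_tester (n : nat) (eps : R) : nacond_alg :=
  if Nat.leb n 1 then no_query_alg
  else
    let B := scale_count n eps in tester n (sample_factor B) (levels n) B.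

Lemma gap_equal (n : nat) (p q : nat -> R) (S T : nat -> bool) :
  (forall i, (1 <= i <= n)%nat -> p i = q i) -> gap n p q S T = 0.
Proof.
  intros Heq. apply Rminus_diag_eq.
  assert (HM : mass n p S = mass n q S).
  { apply lsum_ext. intros i Hi. apply in_seq in Hi. rewrite Heq by lia. reflexivity. }
  apply lsum_ext. intros i Hi. apply in_seq in Hi.
  unfold cond_prob. rewrite HM, (Heq i) by lia. reflexivity.
Qed.

Theorem theorem1 :
  exists (C : R) (k : nat) (A : nat -> R -> nacond_alg),
    forall (n : nat) (eps : R),
      (1 <= n)%nat -> 0 < eps <= 1 ->
      well_formed n (A n eps) /\
      (forall r, (r < na_seeds (A n eps))%nat ->
         INR (length (na_qp (A n eps) r)) <= query_bound C k n eps /\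
         INR (length (na_qq (A n eps) r)) <= query_bound C k n eps) /\
      (forall p q : nat -> R, is_distr n p -> is_distr n q ->
         ((forall i, (1 <= i <= n)%nat -> p i = q i) ->
            out_prob n (A n eps) p q true >= 2 / 3) /\
         (dTV n p q >= eps ->
            out_prob n (A n eps) p q false >= 2 / 3)).
Proof.
  (* The constant and the exponent 2 of the polylogarithmic factor are those of
     [query_count_bound]. *)
  exists (4 * 2048 * 15 * 768 * 16 * 243), 2%nat, equivalence_tester.
  intros n eps Hn Heps. unfold equivalence_tester.
  destruct (Nat.leb_spec n 1) as [Hn1|Hn1].
  { assert (n = 1%nat) as -> by lia. split; [|split].
    - repeat split; simpl; intros; [lra|lra|constructor|constructor].
    - intros r _. simpl length. change (INR 0) with 0. change (INR 1) with 1.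
      unfold query_bound. change (INR 1) with 1. rewrite log2_1.
      rewrite pow_ne_zero by lia. unfold Rdiv. split; right; ring.
    - intros p q [_ Hp] [_ Hq]. split; intros H.
      + unfold out_prob. simpl. lra.
      + exfalso. unfold dTV in H. simpl in H, Hp, Hq.
        replace (p 1%nat - q 1%nat) with 0 in H by lra. rewrite Rabs_R0 in H. lra. }
  set (B := scale_count n eps). set (L := sample_factor B). set (k := levels n).
  assert (HL : (1 <= L)%nat) by (unfold L, sample_factor; lia).
  assert (Hk : 1 <= INR k) by (apply (le_INR 1); unfold k, levels; lia).
  assert (Hk3 : 1 <= INR k ^ 3) by (apply pow_R1_Rle; assumption).
  assert (Hen : 0 < energy n eps <= 1).
  { unfold energy. fold k. split; [apply Rdiv_lt_0_compat; nra|].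
    apply Rmult_le_reg_r with (512 * INR k ^ 3); [lra|].
    unfold Rdiv. rewrite Rmult_assoc, Rinv_l by lra. nra. }
  assert (Hfrac : INR k <= INR k / energy n eps).
  { apply Rmult_le_reg_r with (energy n eps); [lra|].
    unfold Rdiv. rewrite Rmult_assoc, Rinv_l by lra. nra. }
  assert (HB : 2 * INR k / energy n eps <= 2 ^ B).
  { apply log2_ceil_spec. fold k. unfold Rdiv in *. lra. }
  (* Bounding the chain length by [2 ^ B] expresses the union bound in [B] alone. *)
  assert (HkB : INR k <= 2 ^ B) by (unfold Rdiv in *; lra).
  assert (Herr := sample_factor_err B). fold L in Herr.
  set (err := exp (- (INR L / 128))) in *.
  assert (Herr0 : 0 < err) by apply exp_pos.
  assert (HBB : 1 <= 2 ^ B * 2 ^ B) by nra.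
  assert (Herr1 : 64 * (2 ^ B * 2 ^ B) * err <= 1).
  { apply Rmult_le_compat_l with (r := 64 * (2 ^ B * 2 ^ B)) in Herr; [|lra].
    eapply Rle_trans; [exact Herr|]. right. field. nra. }
  split; [apply tester_well_formed|]. split.
  { intros r Hr. pose proof (tester_queries n L k B r Hr) as H.
    pose proof (query_count_bound n eps Hn1 Heps) as H'. cbv zeta in H'. fold B L k in H'.
    cbn [tester na_qp na_qq] in *. split; lra. }
  intros p q Hp Hq. split; intros H.
  - rewrite out_prob_tester_true by assumption. apply Rle_ge.
    eapply Rle_trans; [|apply seed_tests_null; try assumption; intros; now apply gap_equal].
    (* The total error is at most [16 / 64], below 1/3. *)
    fold err. assert (2 ^ B * INR k * err <= 2 ^ B * 2 ^ B * err); [|nra].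
    apply Rmult_le_compat_r; [lra|]. apply Rmult_le_compat_l; lra.
  - rewrite out_prob_tester_false, out_prob_tester_true by assumption. apply Rle_ge.
    assert (Hfar : avg (seeds n k B) (fun s => lprod (seed_tests n L B s) (accept n p q)) <= exp (-2)).
    { apply seed_tests_far with (theta := energy n eps); try assumption; try lra.
      - unfold k, levels. lia.
      - fold err. nra.
      - apply (chain_energy n p q Hp Hq (Nat.log2_up n) eps); [now apply levels_ge|lra]. }
    (* From [exp 2 >= 1 + 2]. *)
    assert (Hexp : exp (-2) * 3 <= 1).
    { pose proof (exp_ineq1_le 2) as H2. pose proof (exp_pos (-2)).
      assert (exp (-2) * exp 2 = 1) by (rewrite <- exp_plus; replace (-2 + 2) with 0 by lra; apply exp_0).
      nra. }
    lra.
Qed.
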